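(* Assume the setting of the context (standing assumptions on $f,h,G$; the accelerated stochastic proximal subgradient method; the quantities $L(\cdot)$, $D_h$, $\Lambda(\cdot)$, $\widetilde\Lambda(\cdot,\cdot)$). Let $\epsilon,\delta\in(0,1)$ be arbitrary, let $K\ge1$ be an integer (the pre-chosen maximum iteration number), and let $$\eta=\min\Big\{\frac{1}{4(L_f+L(\epsilon/K))},\ \Big(\frac{6}{(M_f^2+\Lambda(\epsilon)^2)(2K+3)(K+2)K}\Big)^{\frac12}D_h\Big\},$$ $$\tilde\eta=\min\Big\{\frac{1}{4(L_f+L(\epsilon/K))},\ \Big(\frac{2}{(M_f^2+\widetilde\Lambda(\delta,\epsilon)^2)(K+2)^2K}\Big)^{\frac12}D_h\Big\}.$$ Then the following hold. (i) Let $\{z^k\}$ be generated by the method with $(\gamma_k,\eta_k)=(2/(k+2),(k+2)\eta/2)$ for all $k\ge0$. Then $\mathbb{E}[F(z^K)-F^*]\le\epsilon$ for all $K$ satisfying $$K\ge\max\Big\{\Big(\frac{48D_h^2L_f}{\epsilon}\Big)^{\frac12},\ \Big(\frac{48D_h^2L(\epsilon)}{\epsilon}\Big)^{\frac{1+\nu}{1+3\nu}},\ \frac{(24D_h)^2(M_f+\Lambda(\epsilon))^2}{3\epsilon^2},\ 2\Big\}.$$ (ii) Suppose additionally that $$\mathbb{E}\big[\exp\{\|G(x;\xi)-\mathbb{E}[G(x;\xi)]\|^\alpha/\sigma^\alpha\}\big]\le\exp\{1\}\qquad\forall x\in\mathrm{dom}\,f.$$ Let $\{z^k\}$ be generated by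 the method with $(\gamma_k,\eta_k)=(2/(k+2),(k+2)\tilde\eta/2)$ for all $k\ge0$. Then, with probability at least $1-\delta$, $F(z^K)-F^*\le\epsilon$ holds for all $K$ satisfying $$K\ge\max\Big\{\Big(\frac{64D_h^2L_f}{\epsilon}\Big)^{\frac12},\ \Big(\frac{64D_h^2L(\epsilon)}{\epsilon}\Big)^{\frac{1+\nu}{1+3\nu}},\ \frac{2(16D_h)^2(M_f+\widetilde\Lambda(\delta,\epsilon))^2}{\epsilon^2},\ \Big(\Big(\frac{16\alpha D_h\sigma}{\epsilon}\Big)^{\frac{\alpha}{\alpha-1}}+\mathbb{1}_{(1,2)}(\alpha)\Big)\cdot\frac{\ln(2/\delta)}{\alpha-1},\ 2\Big\}.$$ In both parts the statement is for each fixed $K$ satisfying the stated bound, the parameters being those defined with that $K$.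
   Context: Problem. $F^*:=\min_{x\in\mathbb{R}^n}\{F(x):=f(x)+h(x)\}$, where $f,h:\mathbb{R}^n\to(-\infty,\infty]$ are proper lower semicontinuous convex functions with $\mathrm{dom}\,h\subseteq\mathrm{dom}\,f$. $\|\cdot\|$ is the Euclidean norm and $\partial$ denotes the convex subdifferential. Standing assumptions. (a) There are constants $L_f,H_f,M_f\ge0$ and $\nu\in(0,1)$ such that $$\|f'(y)-f'(x)\|\le L_f\|y-x\|+H_f\|y-x\|^\nu+M_f\qquad\forall f'(y)\in\partial f(y),\ f'(x)\in\partial f(x),\ x,y\in\mathrm{dom}\,f.$$ (b) The proximal operator of $h$, $\mathrm{prox}_{\eta h}(x):=\arg\min_{z\in\mathbb{R}^n}\{h(z)+\frac{1}{2\eta}\|z-x\|^2\}$ ($\eta>0$), can be evaluated exactly, and $\mathrm{dom}\,h$ is bounded. (c) The stochastic subgradient estimator $G:\mathbb{R}^n\times\Xi\to\mathbb{R}^n$ satisfies, for some $\sigma>0$ and $\alpha\in(1,2]$, $$\mathbb{E}[G(x;\xi)]\in\partial f(x),\qquad \mathbb{E}[\|G(x;\xi)-\mathbb{E}[G(x;\xi)]\|^\alpha]\le\sigma^\alpha\qquad\forall x\in\mathrm{dom}\,f.$$ Quantities. $D_h:=\max_{x,y\in\mathrm{dom}\,h}\|x-y\|$ (diameter of $\mathrm{dom}\,h$); since step sizes must be positive, $D_h>0$. For $\varepsilon,\delta>0$, $$L(\varepsilon):=H_f^{\frac{2}{1+\nu}}\Big(\frac{4}{\varepsilon}\Big)^{\frac{1-\nu}{1+\nu}},$$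 $$\Lambda(\varepsilon)^2:=8(\alpha-1)^2\Big(\frac{\sigma}{\alpha}\Big)^{\frac{\alpha}{\alpha-1}}\Big(\frac{8D_h}{\varepsilon}\Big)^{\frac{2-\alpha}{\alpha-1}},\qquad \widetilde\Lambda(\delta,\varepsilon)^2:=\Big(1+\ln\Big(\frac{2}{\delta}\Big)\Big)^{\frac{1}{\alpha-1}}\Lambda(\varepsilon)^2,$$ with $\Lambda,\widetilde\Lambda\ge0$. $\mathbb{1}_{(1,2)}(\alpha)$ equals $1$ if $\alpha\in(1,2)$ and $0$ otherwise. Convention: $1/0=+\infty$. Accelerated stochastic proximal subgradient method. Input: a (deterministic) starting point $x^0=z^0\in\mathrm{dom}\,h$, step sizes $\{\eta_k\}\subset(0,\infty)$, weighting parameters $\{\gamma_k\}\subset(0,1]$. The samples $\xi_0,\xi_1,\dots$ are i.i.d. copies of $\xi$. For $k=0,1,2,\dots$: $$y^k=(1-\gamma_k)z^k+\gamma_kx^k,\qquad x^{k+1}=\mathrm{prox}_{\eta_kh}(x^k-\eta_kG(y^k;\xi_k)),\qquad z^{k+1}=(1-\gamma_k)z^k+\gamma_kx^{k+1}.$$ *)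

(* Defs.v *)
From HB Require Import structures.
From mathcomp Require Import all_boot all_order all_algebra finmap.
From mathcomp Require Import all_classical all_reals all_analysis.

Set Implicit Arguments.
Unset Strict Implicit.
Unset Printing Implicit Defensive.

Import Order.TTheory GRing.Theory Num.Theory.
Import numFieldNormedType.Exports.

Local Open Scope classical_set_scope.
Local Open Scope ring_scope.

Section Euclidean.
Context {R : realType} {n : nat}.
Implicit Types u v : 'rV[R]_n.

Definition dot u v : R := \sum_(j < n) u 0 j * v 0 j.

(* The library norm `|u| on 'rV[R]_n is the sup norm; it induces the same
   topology and the same bounded sets, but is not the norm meant here. *)
Definition enorm u : R := Num.sqrt (dot u u).

(* For unbounded A the supremum does not exist and [sup] returns 0. *)
Definition diameter (A : set 'rV[R]_n) : R :=
  sup [set d | exists x y, [/\ A x, A y & d = enorm (x - y)]].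

End Euclidean.

Notation borel_rV R n := (g_sigma_algebraType (@open 'rV[R]_n)).

Section ConvexAnalysis.
Context {R : realType} {n : nat}.
Implicit Types (f h : 'rV[R]_n -> \bar R) (x y z g : 'rV[R]_n).

Definition effective_domain f : set 'rV[R]_n := [set x | (f x < +oo)%E].

Definition proper_function f : Prop :=
  (forall x, (-oo < f x)%E) /\ effective_domain f !=set0.

(* The weight is kept off 0 and 1, because 0 * +oo = 0 in \bar R. *)
Definition econvex_function f : Prop :=
  forall x y (t : R), 0 < t < 1 ->
    (f (t *: x + (1 - t) *: y)%R <= t%:E * f x + (1 - t)%:E * f y)%E.

(* Empty at points outside the domain when f is proper. *)
Definition subdifferential f x : set 'rV[R]_n :=
  [set g | forall z, (f x + (dot g (z - x))%:E <= f z)%E].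

Definition prox_objective h (eta : R) x z : \bar R :=
  (h z + ((2 * eta)^-1 * enorm (z - x) ^+ 2)%:E)%E.

(* For h proper, lower semicontinuous and convex and for eta > 0 the minimizer
   exists and is unique, so that [get] picks it. *)
Definition prox h (eta : R) x : 'rV[R]_n :=
  get [set p | forall z,
    (prox_objective h eta x p <= prox_objective h eta x z)%E].

Definition objective f h x : \bar R := (f x + h x)%E.

Definition optimal_value f h : \bar R := ereal_inf (range (objective f h)).

End ConvexAnalysis.

Section Stochastic.
Context {R : realType} {n : nat} {dX : measure_display} {Xi : measurableType dX}.
Implicit Types (mu : probability Xi R) (G : 'rV[R]_n -> Xi -> 'rV[R]_n).

(* Here mu is the law of the random sample.  The entries are meaningful only
   when the coordinates of G x are integrable. *)
Definition mean_oracle mu G (x : 'rV[R]_n) : 'rV[R]_n :=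
  \row_j fine ('E_mu[fun s => (G x s 0 j)%R])%E.

Definition oracle_error mu G (x : 'rV[R]_n) (s : Xi) : R :=
  enorm (G x s - mean_oracle mu G x).

Definition mutually_independent {dO : measure_display} {Omega : measurableType dO}
    (P : probability Omega R) (xi : nat -> Omega -> Xi) : Prop :=
  forall (J : {fset nat}) (A : nat -> set Xi), (forall i, measurable (A i)) ->
    P (\bigcap_(i in [set` J]) (xi i @^-1` A i))
    = (\prod_(i <- J) P (xi i @^-1` A i))%E.

(* Two measures on Xi are compared on measurable sets only. *)
Definition iid_samples {dO : measure_display} {Omega : measurableType dO}
    (P : probability Omega R) mu (xi : nat -> Omega -> Xi) : Prop :=
  [/\ forall k, measurable_fun [set: Omega] (xi k),
      forall k (A : set Xi), measurable A -> P (xi k @^-1` A) = mu A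
    & mutually_independent P xi].

(* The pair (x^k, z^k) along one realization s of the samples. *)
Fixpoint prox_subgradient (h : 'rV[R]_n -> \bar R) G (gamma eta : nat -> R)
    (x0 : 'rV[R]_n) (s : nat -> Xi) (k : nat) : 'rV[R]_n * 'rV[R]_n :=
  if k is k'.+1 then
    let: (x, z) := prox_subgradient h G gamma eta x0 s k' in
    let y := (1 - gamma k') *: z + gamma k' *: x in
    let x' := prox h (eta k') (x - eta k' *: G y (s k')) in
    (x', (1 - gamma k') *: z + gamma k' *: x')
  else (x0, x0).

Definition zseq h G gamma eta x0 s k : 'rV[R]_n :=
  (prox_subgradient h G gamma eta x0 s k).2.

End Stochastic.

Section Quantities.
Context {R : realType}.

Definition Lsmooth (Hf nu eps : R) : R :=
  Hf `^ (2 / (1 + nu)) * (4 / eps) `^ ((1 - nu) / (1 + nu)).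

Definition Lambda (alpha sigma Dh eps : R) : R :=
  Num.sqrt (8 * (alpha - 1) ^+ 2 * (sigma / alpha) `^ (alpha / (alpha - 1))
            * (8 * Dh / eps) `^ ((2 - alpha) / (alpha - 1))).

Definition Lambda_tilde (alpha sigma Dh delta eps : R) : R :=
  Num.sqrt ((1 + ln (2 / delta)) `^ ((alpha - 1)^-1)
            * Lambda alpha sigma Dh eps ^+ 2).

(* The minimum of 1/a and b.  The inverse is taken in \bar R, where 1/0 = +oo
   (in R it would be 0); the minimum is finite when a >= 0. *)
Definition min_inv (a b : R) : R := fine (Order.min (a%:E^-1) b%:E)%E.

End Quantities.

(* Main.v *)
(* Write y, x', z' for the points produced from (x, z) in one step, t = |z' - y|,
   e for the oracle error at y and u for a minimizer of F = f + h.  Convexity,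
   the three-point inequality of the prox and the bound on differences of
   subgradients give, for gamma = 2/(k+2) and step eta/gamma,
     F(z') - F(u) <= (1 - gamma) (F(z) - F(u))
        + gamma^2/(2 eta) (|u - x|^2 - |u - x'|^2) + gamma <e, u - x>
        + ((L_f + L) t^2 + M_f t + |e| t - t^2/(2 eta)) + eps/(8K).
   Since t <= gamma D, Young's inequality bounds |e| t by a multiple of |e|^alpha
   plus t^2/(8 eta), so only the alpha-moment of e is used; the quadratic terms
   in t cancel because 4 eta (L_f + L) <= 1.  Multiplying by (k+1)(k+2) and
   telescoping leaves a weighted sum of the |e_k|^alpha and the martingale
   sum of the (k+1) <e_k, u - x_k>, which has mean zero.  For the high
   probability bound the first sum is handled by Jensen's and Markov's
   inequalities applied to exp, the second one by Chernoff's bound, based on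
   exp(s) <= s + exp(|s|^alpha). *)

Require Import Defs.
From HB Require Import structures.
From mathcomp Require Import all_boot all_order all_algebra finmap.
From mathcomp Require Import all_classical all_reals all_analysis.
From mathcomp Require Import measurable_realfun ring lra.

Set Implicit Arguments.
Unset Strict Implicit.
Unset Printing Implicit Defensive.

Import Order.TTheory GRing.Theory Num.Theory.
Import numFieldNormedType.Exports.

Local Open Scope classical_set_scope.
Local Open Scope ring_scope.

(** * Euclidean vectors *)

(** Only an alpha-moment of the noise is available, so |e|^2 may have infinite mean. Boundedness of
    dom h makes up for it: Young's inequality with exponents alpha and q = alpha/(alpha-1) >= 2
    produces t^q, and t <= gamma D turns this into t^2 (gamma D)^(q-2). The coefficient thereby
    forced on |e|^alpha is a product of powers of eta and gamma eps. A second AM-GM separates it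
    into a part of order eta, which is the origin of Lambda^2, and a share gamma eps/8 of the target
    accuracy. The weights (k+1)(k+2) sum to order K^3, while the final gap carries only K(K+1), so a
    constant error per step is amplified by a factor of order K. The Hoelder term is therefore
    smoothed to accuracy eps/K; the share gamma eps/8 decays with k and is summed without this loss.
    Conditional expectations are avoided: the state is a function of the earlier samples and hence
    independent of the next one, so Tonelli's theorem with the state frozen takes the place of
    conditioning. *)

Section EuclideanSpace.
Context {R : realType} {n : nat}.
Implicit Types u v w : 'rV[R]_n.

Lemma dotC u v : dot u v = dot v u.
Proof. by apply: eq_bigr => j _; rewrite mulrC. Qed.

Lemma dotDl u v w : dot (u + v) w = dot u w + dot v w.
Proof. by rewrite -big_split; apply: eq_bigr => j _; rewrite mxE mulrDl. Qed.

Lemma dotZl (a : R) u v : dot (a *: u) v = a * dot u v.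
Proof. by rewrite /dot mulr_sumr; apply: eq_bigr => j _; rewrite mxE mulrA. Qed.

Lemma dotNl u v : dot (- u) v = - dot u v.
Proof. by rewrite -scaleN1r dotZl mulN1r. Qed.

Lemma dotBl u v w : dot (u - v) w = dot u w - dot v w.
Proof. by rewrite dotDl dotNl. Qed.

Lemma dotDr u v w : dot w (u + v) = dot w u + dot w v.
Proof. by rewrite dotC dotDl !(dotC w). Qed.

Lemma dotZr (a : R) u v : dot v (a *: u) = a * dot v u.
Proof. by rewrite dotC dotZl dotC. Qed.

Lemma dotBr u v w : dot w (u - v) = dot w u - dot w v.
Proof. by rewrite dotC dotBl !(dotC w). Qed.

Lemma dot_ge0 u : 0 <= dot u u.
Proof. by apply: sumr_ge0 => j _; rewrite -expr2 sqr_ge0. Qed.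

Lemma enorm_ge0 u : 0 <= enorm u.
Proof. exact: sqrtr_ge0. Qed.

Lemma sqr_enorm u : enorm u ^+ 2 = dot u u.
Proof. by rewrite sqr_sqrtr ?dot_ge0. Qed.

Lemma enormN u : enorm (- u) = enorm u.
Proof. by rewrite /enorm -scaleN1r dotZl dotZr !mulN1r opprK. Qed.

Lemma enorm_sub u v : enorm (u - v) = enorm (v - u).
Proof. by rewrite -opprB enormN. Qed.

Lemma enormZ (a : R) u : enorm (a *: u) = `|a| * enorm u.
Proof.
by rewrite /enorm dotZl dotZr mulrA -expr2 sqrtrM ?sqr_ge0// sqrtr_sqr.
Qed.

Lemma coord_le_enorm u j : `|u 0 j| <= enorm u.
Proof.
rewrite -sqrtr_sqr ler_sqrt ?dot_ge0//.
rewrite /dot (bigD1 j)//= expr2 lerDl.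
by apply: sumr_ge0 => i _; rewrite -expr2 sqr_ge0.
Qed.

Lemma norm_le_enorm u : `|u| <= enorm u.
Proof.
rewrite [leLHS]mx_normrE; apply: bigmax_le; first exact: enorm_ge0.
by move=> [i j] _ /=; rewrite ord1 coord_le_enorm.
Qed.

Lemma coord_le_norm u j : `|u 0 j| <= `|u|.
Proof.
rewrite [leRHS]mx_normrE.
exact: (le_bigmax _ (fun i : 'I_1 * 'I_n => `|u i.1 i.2|) (ord0, j)).
Qed.

Lemma dot_self_le_norm u : dot u u <= n%:R * `|u| ^+ 2.
Proof.
rewrite -[n in n%:R]card_ord mulr_natl -sumr_const; apply: ler_sum => j _.
by rewrite -expr2 -real_normK ?num_real// lerXn2r ?nnegrE// coord_le_norm.
Qed.

Lemma enorm_le_norm u : enorm u <= Num.sqrt n%:R * `|u|.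
Proof.
rewrite -{1}(ger0_norm (normr_ge0 u)) -sqrtr_sqr -sqrtrM// ler_sqrt ?dot_self_le_norm//.
Qed.

Lemma enorm0_eq0 u : enorm u = 0 -> u = 0.
Proof.
by move=> u0; apply/eqP; rewrite -normr_le0 -u0 norm_le_enorm.
Qed.

Lemma Cauchy_Schwarz u v : dot u v <= enorm u * enorm v.
Proof.
have [u0|u0] := eqVneq (enorm u) 0.
  by rewrite (enorm0_eq0 u0) -(scale0r 0) dotZl enormZ normr0 !mul0r.
have [v0|v0] := eqVneq (enorm v) 0.
  by rewrite (enorm0_eq0 v0) -(scale0r 0) dotZr enormZ normr0 !(mul0r, mulr0).
have up : 0 < enorm u by rewrite lt_neqAle eq_sym u0 enorm_ge0.
have vp : 0 < enorm v by rewrite lt_neqAle eq_sym v0 enorm_ge0.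
have := dot_ge0 (enorm v *: u - enorm u *: v).
rewrite !(dotBl, dotBr, dotZl, dotZr) (dotC v u) -!sqr_enorm => H.
have : 0 <= 2 * (enorm u * enorm v) * (enorm u * enorm v - dot u v) by nra.
by rewrite pmulr_rge0 ?subr_ge0// !mulr_gt0.
Qed.

Lemma norm_dot_le u v : `|dot u v| <= enorm u * enorm v.
Proof.
by rewrite ler_norml Cauchy_Schwarz andbT lerNl -dotNl -(enormN u) Cauchy_Schwarz.
Qed.

Lemma le_diameter (A : set 'rV[R]_n) u v : bounded_set A -> A u -> A v ->
  enorm (u - v) <= diameter A.
Proof.
move=> [M [Mr MA]] Au Av; apply: ub_le_sup; last by exists u, v.
exists (Num.sqrt n%:R * (2 * (M + 1))) => _ [x [y [Ax Ay ->]]].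
apply: (le_trans (enorm_le_norm _)); rewrite ler_wpM2l// (le_trans (ler_normB _ _))//.
have M1 : M < M + 1 by rewrite ltrDl.
by have := MA _ M1 _ Ax; have := MA _ M1 _ Ay => /=; lra.
Qed.

End EuclideanSpace.

(** * Minimizers of lower semicontinuous functions and the proximal operator *)

Section ConvexAnalysis.
Context {R : realType} {n : nat}.
Implicit Types (f h phi : 'rV[R]_n -> \bar R) (u v w x y z p : 'rV[R]_n).

Lemma ereal_dense (a b : \bar R) : (a < b)%E ->
  exists r : R, (a < r%:E)%E /\ (r%:E < b)%E.
Proof.
case: a => [a| |]; case: b => [b| |] //= ab.
- rewrite lte_fin in ab; exists ((a + b) / 2).
  by rewrite !lte_fin !midf_lt.
- by exists (a + 1); rewrite lte_fin ltrDl ltry.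
- by exists (b - 1); rewrite lte_fin ltrBlDr ltrDl ltNyr.
- by exists 0; rewrite ltNyr ltry.
Qed.

(** The strict sublevel sets above the infimum generate a proper filter; level +oo gives the
    effective domain, which lies in a compact ball. A cluster point of this filter is a minimizer,
    since lower semicontinuity would keep a value above the infimum away from some sublevel set. *)
Lemma lsc_argmin phi : lower_semicontinuous phi ->
  bounded_set (effective_domain phi) -> effective_domain phi !=set0 ->
  exists p, forall z, (phi p <= phi z)%E.
Proof.
move=> phi_lsc bdom [x0 x0dom].
pose I := ereal_inf (range phi).
have Iphi z : (I <= phi z)%E by apply: ereal_inf_lbound; exists z.
have sub_ne a : (I < a)%E -> exists z, (phi z < a)%E.
  by move=> /ereal_inf_lt[_ [z _ <-] za]; exists z.
have [M [Mr MA]] := bdom.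
pose A := [set x : 'rV[R]_n | `|x| <= M + 1].
have cA : compact A.
  apply: bounded_closed_compact.
    by exists (M + 1); split; [exact: num_real|move=> y My x /le_trans; apply; exact: ltW].
  rewrite (_ : A = (fun x : 'rV[R]_n => `|x|) @^-1` [set r | r <= M + 1])//.
  apply: closed_comp; last exact: closed_le.
  by move=> x _; exact: norm_continuous.
have domA : effective_domain phi `<=` A by move=> x; apply: MA; rewrite ltrDl.
pose F : set_system 'rV[R]_n := fun B =>
  exists a, [/\ (I < a)%E & [set z | (phi z < a)%E] `<=` B].
have FF : ProperFilter F.
  apply: Build_ProperFilter_ex => [B [a [Ia aB]]|].
    by have [z za] := sub_ne _ Ia; exists z; exact: aB.
  split.
  - by exists +oo%E; split=> //; exact: le_lt_trans (Iphi x0) x0dom.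
  - move=> B C [a [Ia aB]] [b [Ib bC]]; exists (Order.min a b); split.
      by rewrite lt_min Ia.
    by move=> z /=; rewrite lt_min => /andP[za zb]; split; [exact: aB|exact: bC].
  - by move=> B C BC [a [Ia aB]]; exists a; split=> // z /aB /BC.
have FA : F A.
  by exists +oo%E; split; [exact: le_lt_trans (Iphi x0) x0dom|exact: domA].
have [p [_ clp]] := cA F FF FA.
exists p => z; apply: le_trans (Iphi z).
rewrite leNgt; apply/negP => /ereal_dense[a [Ia ap]].
have [V Vp VP] := phi_lsc p a ap.
have Fa : F [set z | (phi z < a%:E)%E] by exists a%:E; split.
have [y [ya Vy]] : [set z | (phi z < a%:E)%E] `&` V !=set0 by exact: clp.
by have := lt_trans ya (VP y Vy); rewrite ltxx.
Qed.

Lemma dom_fin_num f x : proper_function f -> effective_domain f x ->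
  f x \is a fin_num.
Proof. by move=> [f_gt _] fx; rewrite fin_numElt f_gt. Qed.

Lemma econvex_dom f x y (t : R) : econvex_function f -> proper_function f ->
  0 < t <= 1 -> effective_domain f x -> effective_domain f y ->
  effective_domain f (t *: x + (1 - t) *: y)
  /\ fine (f (t *: x + (1 - t) *: y)) <= t * fine (f x) + (1 - t) * fine (f y).
Proof.
move=> cf pf /andP[t0]; rewrite le_eqVlt => /predU1P[->|t1] fx fy.
  by rewrite subrr scale0r addr0 scale1r mul1r mul0r addr0.
have /(cf x y) : 0 < t < 1 by rewrite t0.
rewrite -(fineK (dom_fin_num pf fx)) -(fineK (dom_fin_num pf fy)) -!EFinM -EFinD.
move=> H; have d : effective_domain f (t *: x + (1 - t) *: y).
  exact: le_lt_trans H (ltry _).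
by split=> //; rewrite -lee_fin (fineK (dom_fin_num pf d)).
Qed.

Lemma continuous_dot_self : continuous (fun x : 'rV[R]_n => dot x x).
Proof.
move=> x; apply: cvg_big => [| |j _]; first exact: add_continuous.
  exact: nbhs_filter.
by apply: cvgM; [exact: nbhs_filter|exact: (@coord_continuous R 1 n 0 j x)..].
Qed.

Lemma lsc_continuous (q : 'rV[R]_n -> R) :
  continuous q -> lower_semicontinuous (fun x => (q x)%:E).
Proof.
move=> cq; apply/lower_semicontinuousP => a.
rewrite (_ : [set x | _] = q @^-1` [set r | a < r]).
  by apply: open_comp => // x _; exact: cq.
by apply/seteqP; split=> x /=; rewrite lte_fin.
Qed.

Lemma lscD f h : (forall x, (-oo < f x)%E) -> (forall x, (-oo < h x)%E) ->
  lower_semicontinuous f -> lower_semicontinuous h ->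
  lower_semicontinuous (fun x => (f x + h x)%E).
Proof.
move=> f_gt h_gt lf lh x a afh.
(* If both values are finite, each gives up half of the excess over [a]; if one is infinite, it
   takes whatever the other leaves of [a]. *)
have [b [c [bf ch abc]]] : exists b c : R,
    [/\ (b%:E < f x)%E, (c%:E < h x)%E & a <= b + c].
  move: afh (f_gt x) (h_gt x).
  case: (f x) => [r| |]//; case: (h x) => [s| |]//.
  - rewrite -EFinD lte_fin => ars _ _; exists (r - (r + s - a) / 2), (s - (r + s - a) / 2).
    by rewrite !lte_fin; split; lra.
  - by move=> _ _ _; exists (r - 1), (a - r + 1); rewrite !lte_fin ltry; split=> //; lra.
  - by move=> _ _ _; exists (a - s + 1), (s - 1); rewrite !lte_fin ltry; split=> //; lra.
  - by move=> _ _ _; exists a, 0; rewrite !ltry addr0.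
have [V Vx VP] := lf x b bf; have [W Wx WP] := lh x c ch.
exists (V `&` W); first exact: filterI.
move=> y [/VP by_ /WP cy]; apply: (@le_lt_trans _ _ (b%:E + c%:E)%E).
  by rewrite -EFinD lee_fin.
exact: lteD.
Qed.

(** * The proximal operator of a convex function with bounded domain *)

Section Prox.
Variables (h : 'rV[R]_n -> \bar R) (eta : R).
Hypotheses (h_proper : proper_function h) (h_lsc : lower_semicontinuous h).
Hypotheses (h_convex : econvex_function h) (eta_gt0 : 0 < eta).
Hypothesis h_bounded : bounded_set (effective_domain h).

(** The quadratic term is finite, so the objective has the bounded domain of [h] and attains its
    minimum without a coercivity argument; [get] then returns a minimizer. *)
Lemma prox_min w z :
  (prox_objective h eta w (prox h eta w) <= prox_objective h eta w z)%E.
Proof.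
suff /getPex/(_ z) : exists p, [set p | forall z,
  (prox_objective h eta w p <= prox_objective h eta w z)%E] p by [].
have domE : effective_domain (prox_objective h eta w) = effective_domain h.
  apply/seteqP; split=> x; rewrite /effective_domain /prox_objective /=.
    by case: (h x) (h_proper.1 x).
  by move=> hx; rewrite lte_add_pinfty// ltry.
apply: lsc_argmin; rewrite ?domE//; last by case: h_proper.
apply: (@lscD h (fun z => ((2 * eta)^-1 * enorm (z - w) ^+ 2)%:E)) => //.
- by case: h_proper.
- by move=> x; rewrite ltNyr.
apply: (@lsc_continuous (fun z => (2 * eta)^-1 * enorm (z - w) ^+ 2)).
rewrite (_ : (fun _ => _) = ( *%R (2 * eta)^-1) \o
  ((fun y => dot y y) \o (fun y => y - w))); last first.
  by apply/funext => y /=; rewrite sqr_enorm.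
move=> x; apply: continuous_comp; last exact: mulrl_continuous.
apply: continuous_comp; last exact: continuous_dot_self.
by apply: continuousB; [exact: cvg_id|exact: cst_continuous].
Qed.

Lemma prox_dom w : effective_domain h (prox h eta w).
Proof.
have [_ [x hx]] := h_proper.
have x_lt : (prox_objective h eta w x < +oo)%E by rewrite lte_add_pinfty// ltry.
have := le_lt_trans (prox_min w x) x_lt; rewrite /prox_objective /effective_domain /=.
by case: (h (prox h eta w)) (h_proper.1 (prox h eta w)).
Qed.

(* First-order optimality of the prox: test the minimizer against
   p + t (u - p) and let t tend to 0. *)
Lemma prox_variational w u (p := prox h eta w) : effective_domain h u ->
  fine (h p) <= fine (h u) + eta^-1 * dot (p - w) (u - p).
Proof.
move=> hu; have hp := prox_dom w; rewrite -/p in hp.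
rewrite -subr_ge0; set c := fine (h p).
set a := fine (h u) + _ - c; set b := (2 * eta)^-1 * dot (u - p) (u - p).
have b0 : 0 <= b by rewrite mulr_ge0 ?dot_ge0// invr_ge0 mulr_ge0// ltW.
suff H t : 0 < t <= 1 -> 0 <= a + t * b.
  rewrite leNgt; apply/negP => a0.
  (* This t keeps t b below - a / 2, so that a + t b < 0; the summand 1 avoids division by zero when
     b = 0. *)
  have t01 : 0 < Num.min 1 (- a / (2 * (b + 1))) <= 1.
    rewrite lt_min ltr01 ge_min lexx/= divr_gt0 ?oppr_gt0//.
    by rewrite mulr_gt0// ltr_wpDl.
  have := H _ t01; apply/negP; rewrite -ltNge.
  have : Num.min 1 (- a / (2 * (b + 1))) * b <= - a / 2.
    apply: (@le_trans _ _ (- a / (2 * (b + 1)) * b)).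
      by rewrite ler_wpM2r// ge_min lexx orbT.
    rewrite -[leRHS]mulr1 invfM -!mulrA ler_wpM2l ?oppr_ge0 ?(ltW a0)//.
    rewrite ler_wpM2l// mulrC ler_pdivrMr ?mul1r ?lerDl//.
    by rewrite ltr_wpDl.
  by lra.
move=> t01; have [d] := econvex_dom h_convex h_proper t01 hu hp.
set z := t *: u + (1 - t) *: p => hz.
have := prox_min w z.
rewrite /prox_objective -/p -(fineK (dom_fin_num h_proper hp)).
rewrite -(fineK (dom_fin_num h_proper d)) -!EFinD lee_fin -/c !sqr_enorm.
have -> : z - w = (p - w) + t *: (u - p).
  by apply/rowP => j; rewrite !mxE; ring.
rewrite /a /b; move: (p - w) (u - p) => q r.
rewrite dotDl !dotDr !dotZl !dotZr (dotC r q) => H.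
have t0 : 0 < t by case/andP: t01.
rewrite -(pmulr_rge0 _ t0).
have eta0 : eta != 0 by rewrite gt_eqF.
have -> : t * (fine (h u) + eta^-1 * dot q r - c
   + t * ((2 * eta)^-1 * dot r r)) =
  t * fine (h u) - t * c + (2 * eta)^-1 *
   (2 * (t * dot q r) + t * (t * dot r r)) by field.
move: H; rewrite !mulrDr; move: hz; rewrite -/c; lra.
Qed.

(** The variational inequality at x - eta g, with 2 <p - x, u - p> rewritten as a difference of
    squared norms by polarization. *)
Lemma prox_three_point x g u (p := prox h eta (x - eta *: g)) :
  effective_domain h u ->
  fine (h p) <= fine (h u) + dot g (u - p)
    + (2 * eta)^-1 * (enorm (u - x) ^+ 2 - enorm (u - p) ^+ 2 - enorm (p - x) ^+ 2).
Proof.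
move=> /(prox_variational (x - eta *: g)); rewrite -/p => /le_trans; apply.
have -> : p - (x - eta *: g) = (p - x) + eta *: g.
  by apply/rowP => j; rewrite !mxE; ring.
have -> : u - x = (u - p) + (p - x) by rewrite subrKA.
rewrite !sqr_enorm; move: (p - x) (u - p) => q r.
rewrite !(dotDl, dotDr, dotZl, dotZr) (dotC r q) le_eqVlt; apply/orP; left.
by apply/eqP; field; rewrite gt_eqF.
Qed.

(** Adding the variational inequalities at [w] and [w'] yields firm nonexpansiveness. The purpose is
    continuity of the prox, hence measurability of the iterates. *)
Lemma prox_nonexpansive w w' :
  enorm (prox h eta w - prox h eta w') <= enorm (w - w').
Proof.
set p := prox h eta w; set p' := prox h eta w'.
have := prox_variational w (prox_dom w'); have := prox_variational w' (prox_dom w).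
rewrite -/p -/p' => H H'.
have := lerD H H'; rewrite addrACA [leLHS]addrC lerDl -mulrDr.
rewrite pmulr_rge0 ?invr_gt0// => K.
have {}K : enorm (p - p') ^+ 2 <= dot (w - w') (p - p').
  rewrite sqr_enorm -subr_ge0; apply: le_trans K _.
  have -> : dot (p - w) (p' - p) = - dot (p - w) (p - p').
    by rewrite -(opprB p p') dotC dotNl dotC.
  rewrite -!dotBl le_eqVlt; apply/orP; left.
  by apply/eqP; congr (dot _ _); apply/rowP => j; rewrite !mxE; ring.
have [->|p0] := eqVneq (enorm (p - p')) 0; first exact: enorm_ge0.
have pp : 0 < enorm (p - p') by rewrite lt_neqAle eq_sym p0 enorm_ge0.
rewrite -(ler_pM2r pp) -expr2; apply: le_trans K _; exact: Cauchy_Schwarz.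
Qed.

Lemma prox_continuous : continuous (prox h eta).
Proof.
move=> w; apply/(@cvgrPdist_le _ _ _ (nbhs w) (nbhs_filter w)) => /= e e0.
(* The summand 1 keeps the constant positive when n = 0. *)
have s0 : 0 < Num.sqrt n%:R + 1 :> R by rewrite ltr_wpDl ?sqrtr_ge0.
apply: nbhs_le_nbhs_norm; exists (e / (Num.sqrt n%:R + 1)); first exact: divr_gt0.
move=> w' /=; rewrite ltr_pdivlMr// => /ltW we.
apply: le_trans (norm_le_enorm _) _; apply: le_trans (prox_nonexpansive _ _) _.
apply: le_trans (enorm_le_norm _) _; apply: le_trans we.
by rewrite mulrC ler_wpM2l// lerDl.
Qed.

End Prox.
End ConvexAnalysis.

(** * Borel structure on vectors *)

Section BorelVectors.
Context {R : realType} {n : nat}.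

Lemma open_borel_rV (U : set 'rV[R]_n) :
  open U -> measurable (U : set (borel_rV R n)).
Proof. by move=> oU; exact: sub_sigma_algebra. Qed.

Lemma measurable_coord (j : 'I_n) :
  measurable_fun [set: borel_rV R n] (fun x : borel_rV R n => (x : 'rV[R]_n) 0 j).
Proof.
apply: (measurability _ (RGenOInfty.measurableE R)) => _ [_ [a ->] <-].
rewrite setTI; apply: open_borel_rV; apply: open_comp; last exact: interval_open.
by move=> x _; exact: (@coord_continuous R 1 n 0 j x).
Qed.

Lemma measurable_continuous_rV (g : 'rV[R]_n -> 'rV[R]_n) : continuous g ->
  measurable_fun [set: borel_rV R n] (g : borel_rV R n -> borel_rV R n).
Proof.
move=> /continuousP cg.
apply: (@measurability _ _ _ (borel_rV R n) _ _ (@open 'rV[R]_n) erefl).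
by move=> _ [U oU <-]; rewrite setTI; apply: open_borel_rV; exact: cg.
Qed.

Lemma measurable_lsc_rV (g : 'rV[R]_n -> \bar R) : lower_semicontinuous g ->
  measurable_fun [set: borel_rV R n] (g : borel_rV R n -> \bar R).
Proof.
move=> /lower_semicontinuousP g_lsc.
apply: (measurability _ (ErealGenOInfty.measurableE R)) => _ [_ [a ->] <-].
rewrite setTI; apply: open_borel_rV; rewrite preimage_itvoy; exact: g_lsc.
Qed.

(** Cubes with rational centre and radius 1/(k+1) form a countable base of the topology, which
    reduces Borel measurability of a vector to that of its coordinates. *)
Let box (c : 'rV[rat]_n * nat) : set 'rV[R]_n :=
  [set x | forall j, `|x 0 j - ratr (c.1 0 j)| < c.2.+1%:R^-1].

(** Cubes not contained in [U] are replaced by the empty set, so that the union always runs over the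
    same countable type. *)
Let open_bigcup_box (U : set 'rV[R]_n) : open U ->
  U = \bigcup_(c in [set: 'rV[rat]_n * nat])
        (if `[< box c `<=` U >] then box c else set0).
Proof.
move=> oU; apply/seteqP; split=> [x Ux|x [c _]]; last first.
  by case: asboolP => [cU /cU|].
have /nbhs_norm_le_nbhs[e /= e0 eU] : nbhs x U by exact: open_nbhs_nbhs.
have e20 : 0 < e / 2 by rewrite divr_gt0.
have [k ke] : exists k : nat, k.+1%:R^-1 < e / 2.
  exists (Num.trunc (e / 2)^-1); rewrite invf_plt ?posrE//.
  exact: truncnS_gt.
have k0 : 0 < k.+1%:R^-1 :> R by rewrite invr_gt0.
have /choice[q qP] (j : 'I_n) : exists q : rat, `|x 0 j - ratr q| < k.+1%:R^-1.
  have [|q] := @rat_in_itvoo R (x 0 j - k.+1%:R^-1) (x 0 j + k.+1%:R^-1).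
    by rewrite ltrBlDr -addrA ltrDl addr_gt0.
  rewrite in_itv/= => /andP[q1 q2]; exists q.
  rewrite ltr_norml; move: (ratr q) q1 q2 => r; move: k.+1%:R^-1 => s q1 q2.
  by apply/andP; split; lra.
pose c := (\row_j q j, k); have cx : box c x by move=> j; rewrite mxE.
suff cU : box c `<=` U by exists c => //; case: asboolP.
move=> y cy; apply: eU => /=.
rewrite [ltLHS]mx_normrE; apply: bigmax_lt => // -[i j] _ /=; rewrite ord1 !mxE.
have := cx j; have := cy j; rewrite !mxE/= !ltr_norml.
move: (ratr (q j)) k.+1%:R^-1 ke => r s {k0} ke /andP[y1 y2] /andP[x1 x2].
by apply/andP; split; lra.
Qed.

Lemma measurable_borel_rV d (T : measurableType d) (u : T -> 'rV[R]_n) :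
  (forall j, measurable_fun [set: T] (fun t => u t 0 j)) ->
  measurable_fun [set: T] (u : T -> borel_rV R n).
Proof.
move=> mu_; apply: (@measurability _ _ _ (borel_rV R n) _ _ (@open 'rV[R]_n) erefl).
move=> _ [U oU <-]; rewrite setTI (open_bigcup_box oU) preimage_bigcup.
apply: countable_bigcupT_measurable => [|c]; first exact: countableP.
case: asboolP => _; last by rewrite preimage_set0.
rewrite (_ : _ @^-1` _ =
  \bigcap_(j in [set: 'I_n]) [set t | `|u t 0 j - ratr (c.1 0 j)| < c.2.+1%:R^-1]).
  apply: fin_bigcap_measurable => [|j _]; first exact: finite_finset.
  have := @measurable_lte _ T R setT measurableT
    (fun t => (`|u t 0 j - ratr (c.1 0 j)|)%:E) (cst (c.2.+1%:R^-1)%:E).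
  rewrite setTI; under eq_set do rewrite /= lte_fin.
  apply => //; apply/measurable_EFinP; apply: measurableT_comp => //.
  exact: measurable_funB.
by apply/seteqP; split=> t /= H j; [move=> _|]; exact: H.
Qed.

End BorelVectors.

(** * Chains driven by independent samples *)

Section JointLaw.
Context {R : realType} {dO : measure_display} {Omega : measurableType dO}.
Context {d1 : measure_display} {T1 : measurableType d1}.
Context {d2 : measure_display} {T2 : measurableType d2}.
Variables (P : probability Omega R) (mu : probability T2 R).

Definition mfun_pack (X : Omega -> T1) (mX : measurable_fun [set: Omega] X) :
  {mfun Omega >-> T1} := HB.pack X (isMeasurableFun.Build _ _ _ _ _ mX).

Variables (X : Omega -> T1) (mX : measurable_fun [set: Omega] X).
Variables (Y : Omega -> T2) (mY : measurable_fun [set: Omega] Y).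

Let law : probability T1 R := distribution P (mfun_pack mX).

(** Conditionally on [E], the law of (X, Y) agrees with the product measure on rectangles, hence
    everywhere by uniqueness of product measures; the case P E = 0 is trivial. [E] will be an event
    about later samples, carried along for the induction on the chain. *)
Lemma joint_law_restr (E : set Omega) : measurable E ->
  (forall A B, measurable A -> measurable B ->
     P (X @^-1` A `&` Y @^-1` B `&` E) = P (X @^-1` A) * mu B * P E)%E ->
  forall C, measurable C ->
    P ((fun w => (X w, Y w)) @^-1` C `&` E) = ((law \x mu) C * P E)%E.
Proof.
move=> mE indep C mC.
have mXY := measurable_fun_pair mX mY.
have mC' : measurable ((fun w => (X w, Y w)) @^-1` C).
  by rewrite -[X in measurable X]setTI; exact: mXY.
have [PE0|PE0] := eqVneq (P E) 0%E.
  apply/eqP; rewrite PE0 mule0 eq_le measure_ge0 andbT -PE0.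
  by apply: le_measure; rewrite ?inE//; exact: measurableI.
have PEf : P E \is a fin_num by exact: fin_num_measure.
have c0 : 0 < fine (P E) by rewrite fine_gt0// lt0e PE0 measure_ge0 ltey_eq PEf.
have ci0 : 0 <= (fine (P E))^-1 by rewrite invr_ge0 ltW.
pose m' := mscale (NngNum ci0) (mrestr P mE).
have -> : ((law \x mu) C = pushforward m' (fun w => (X w, Y w)) C)%E.
  apply: (@product_measure_unique _ _ _ _ _ law mu (pushforward m' _)) => // A B mA mB.
  rewrite /= /pushforward /m' /mscale /mrestr/=.
  rewrite (_ : _ @^-1` (A `*` B) = X @^-1` A `&` Y @^-1` B)// [X in (_ * X)%E](indep _ _ mA mB).
  by rewrite muleC -muleA -(fineK PEf) -EFinM mulfV ?gt_eqF// mule1.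
rewrite /pushforward /m' /mscale /mrestr/= -[P E in RHS](fineK PEf) muleC muleA -EFinM.
by rewrite mulfV ?gt_eqF// mul1e.
Qed.

Lemma joint_law : (forall A B, measurable A -> measurable B ->
    P (X @^-1` A `&` Y @^-1` B) = P (X @^-1` A) * mu B)%E ->
  forall C, measurable C -> P ((fun w => (X w, Y w)) @^-1` C) = (law \x mu)%E C.
Proof.
move=> indep C mC.
have H A B : measurable A -> measurable B ->
    (P (X @^-1` A `&` Y @^-1` B `&` setT) = P (X @^-1` A) * mu B * P setT)%E.
  by move=> mA mB; rewrite setIT probability_setT mule1 indep.
by have := joint_law_restr measurableT H mC; rewrite setIT probability_setT mule1.
Qed.

Hypothesis indep : forall A B, measurable A -> measurable B ->
  P (X @^-1` A `&` Y @^-1` B) = (P (X @^-1` A) * mu B)%E.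

(** Stands in for conditioning on X: the inner integral freezes the state and averages over a fresh
    sample. *)
Lemma ge0_integral_indep (phi : T1 * T2 -> \bar R) :
  measurable_fun [set: T1 * T2] phi -> (forall p, 0 <= phi p)%E ->
  (\int[P]_w phi (X w, Y w) = \int[P]_w \int[mu]_y phi (X w, y))%E.
Proof.
move=> mphi phi0; have mXY := measurable_fun_pair mX mY.
transitivity (\int[pushforward P (fun w => (X w, Y w))]_z phi z)%E.
  by rewrite ge0_integral_pushforward.
rewrite (eq_measure_integral (law \x mu)%E); last first.
  by move=> A mA _; rewrite /= -joint_law.
rewrite fubini_tonelli1//.
rewrite -[RHS](@ge0_integral_pushforward _ _ _ _ _ X mX P setT
   (fun x => \int[mu]_y phi (x, y))%E)//.
- exact: (@measurable_fun_fubini_tonelli_F _ _ _ _ _ mu).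
- by move=> x _; exact: integral_ge0.
Qed.

End JointLaw.

(** * Independence of the current state of a chain from the samples not yet used *)

Section IidChain.
Context {R : realType} {dX : measure_display} {Xi : measurableType dX}.
Context {dO : measure_display} {Omega : measurableType dO}.
Variables (P : probability Omega R) (mu : probability Xi R).
Variables (xi : nat -> Omega -> Xi) (xi_iid : iid_samples P mu xi).
Context {dT : measure_display} {T : measurableType dT}.
Variables (t0 : T) (Phi : nat -> T -> Xi -> T).
Hypothesis mPhi : forall k,
  measurable_fun [set: T * Xi] (fun p : T * Xi => Phi k p.1 p.2).

Fixpoint chain (s : nat -> Xi) (k : nat) : T :=
  if k is k'.+1 then Phi k' (chain s k') (s k') else t0.

Local Notation W k := (fun w => chain (xi ^~ w) k).

Lemma measurable_chain k : measurable_fun [set: Omega] (W k).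
Proof.
have [mxi _ _] := xi_iid; elim: k => [|k IH] /=; first exact: measurable_cst.
exact: (measurableT_comp (mPhi k) (measurable_fun_pair IH (mxi k))).
Qed.

Let future (J : {fset nat}) (A : nat -> set Xi) : set Omega :=
  \bigcap_(i in [set` J]) (xi i @^-1` A i).

Let measurable_future J A : (forall i, measurable (A i)) -> measurable (future J A).
Proof.
have [mxi _ _] := xi_iid; move=> mA; apply: fin_bigcap_measurable => // i _.
by rewrite -[X in measurable X]setTI; exact: mxi.
Qed.

Let future_cons (J : {fset nat}) A k (B : set Xi) : (forall i, i \in J -> (k < i)%N) ->
  (forall i, measurable (A i)) -> measurable B ->
  let A' i := if i == k then B else A i in
  future (k |` J)%fset A' = xi k @^-1` B `&` future J A
  /\ (P (future (k |` J)%fset A') = mu B * P (future J A))%E.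
Proof.
move=> Jk mA mB A'; have [_ law ind] := xi_iid.
have mA' i : measurable (A' i) by rewrite /A'; case: eqP.
have kJ : k \notin J by apply/negP => /Jk; rewrite ltnn.
have A'E i : i \in J -> A' i = A i.
  by rewrite /A' => iJ; case: eqP => // ik; rewrite -ik iJ in kJ.
split.
  apply/seteqP; split=> w /=.
    move=> H; split.
      by have := H k; rewrite /A' /= eqxx; apply; rewrite in_fset1U eqxx.
    by move=> i /= iJ; have := H i; rewrite /= in_fset1U iJ orbT A'E//; exact.
  move=> [Hk H] i /=; rewrite in_fset1U => /predU1P[->|iJ].
    by rewrite /A' eqxx.
  by rewrite A'E//; exact: H.
rewrite /future ind// big_fsetU1//= law// {1}/A' eqxx; congr (_ * _)%E.
by rewrite ind//; apply: eq_big_seq => i iJ; rewrite A'E.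
Qed.

Let chain_indep_future k (J : {fset nat}) A : (forall i, measurable (A i)) ->
  (forall i, i \in J -> (k <= i)%N) -> forall B, measurable B ->
  P (W k @^-1` B `&` future J A) = (P (W k @^-1` B) * P (future J A))%E.
Proof.
have [mxi _ _] := xi_iid.
elim: k J A => [|k IH] J A mA Jk B mB.
  rewrite (_ : _ @^-1` B = if t0 \in B then setT else set0).
    case: ifP => _; first by rewrite setTI probability_setT mul1e.
    by rewrite set0I measure0 mul0e.
  by rewrite preimage_cst.
have mE := measurable_future J mA.
have rect A' B' : measurable A' -> measurable B' ->
    (P (W k @^-1` A' `&` xi k @^-1` B' `&` future J A)
     = P (W k @^-1` A') * mu B' * P (future J A))%E.
  move=> mA' mB'; have [E1 E2] := future_cons Jk mA mB'.
  rewrite -setIA -E1 IH//.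
  - by rewrite E2 muleA.
  - by move=> i; case: eqP.
  - by move=> i; rewrite in_fset1U => /predU1P[->//|/Jk/ltnW].
have rect' A' B' : measurable A' -> measurable B' ->
    (P (W k @^-1` A' `&` xi k @^-1` B') = P (W k @^-1` A') * mu B')%E.
  move=> mA' mB'; have F0 : forall i, i \in (fset0 : {fset nat}) -> (k < i)%N by [].
  have [E1 E2] := future_cons F0 mA mB'.
  have FT : future fset0 A = setT by apply/seteqP; split=> w.
  rewrite FT probability_setT mule1 setIT in E1 E2; rewrite -E1 IH ?E2//.
  - by move=> i; case: eqP.
  - by move=> i; rewrite in_fset1U => /predU1P[->|].
have mC : measurable ((fun p : T * Xi => Phi k p.1 p.2) @^-1` B).
  by rewrite -[X in measurable X]setTI; exact: mPhi.
(* The product measure of this preimage is the probability that the state at k+1 lies in B, by the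
   same identity with an empty set of future constraints. *)
have := joint_law_restr (measurable_chain k) (mxi k) mE rect mC.
by rewrite -(joint_law (measurable_chain k) (mxi k) rect' mC).
Qed.

Lemma chain_indep k A B : measurable A -> measurable B ->
  (P (W k @^-1` A `&` xi k @^-1` B) = P (W k @^-1` A) * mu B)%E.
Proof.
move=> mA mB; have F0 : forall i, i \in (fset0 : {fset nat}) -> (k < i)%N by [].
have mT (i : nat) : measurable [set: Xi] by [].
have [E1 E2] := future_cons F0 mT mB.
have FT : future fset0 (fun=> setT) = setT by apply/seteqP; split=> w.
rewrite FT probability_setT mule1 setIT in E1 E2.
rewrite -E1 chain_indep_future ?E2//.
- by move=> i; case: eqP.
- by move=> i; rewrite in_fset1U => /predU1P[->|].
Qed.

Lemma ge0_integral_chain k (phi : T * Xi -> \bar R) :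
  measurable_fun [set: T * Xi] phi -> (forall p, 0 <= phi p)%E ->
  (\int[P]_w phi (W k w, xi k w) = \int[P]_w \int[mu]_s phi (W k w, s))%E.
Proof.
have [mxi _ _] := xi_iid; move=> mphi phi0.
exact: (ge0_integral_indep (measurable_chain k) (mxi k) (chain_indep k)).
Qed.

End IidChain.

(** * Stochastic oracle *)

Section ExpInequalities.
Context {R : realType}.
Implicit Types x y s a : R.

(* exp(-y/8) >= 1 - y/8, hence exp(-y) >= (1 - y/8)^8, for y in [0, 1]. *)
Lemma expR_le_quadratic y : `|y| <= 1 -> expR y <= 1 + y + y ^+ 2.
Proof.
rewrite ler_norml => /andP[y1 y2].
suff H : 1 <= expR (- y) * (1 + y + y ^+ 2).
  by move: H; rewrite expRN mulrC ler_pdivlMr ?expR_gt0// mul1r.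
have q0 : 0 <= 1 + y + y ^+ 2 by nra.
have [y0|y0] := leP 0 y; last first.
  (* For y < 0 one factor is enough: (1 - y)(1 + y + y^2) = 1 - y^3 >= 1. *)
  apply: le_trans (ler_wpM2r q0 (expR_ge1Dx (- y))); nra.
have -> : expR (- y) = expR (- y / 8) ^+ 8.
  by rewrite -expRM_natl; congr expR; field.
have b0 : 0 <= 1 - y / 8 by lra.
have : (1 - y / 8) ^+ 8 <= expR (- y / 8) ^+ 8.
  by rewrite lerXn2r ?nnegrE ?expR_ge0// -mulNr expR_ge1Dx.
move=> /(ler_wpM2r q0); apply: le_trans.
set z := y / 8; have -> : y = 8 * z by rewrite /z; field.
have z0 : 0 <= z by rewrite /z; lra.
have z1 : z <= 1 / 8 by rewrite /z; lra.
(* The binomial expansion cut after degree 5; the omitted terms have a nonnegative sum. *)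
have T5 : 1 - 8 * z + 28 * z ^+ 2 - 56 * z ^+ 3 + 70 * z ^+ 4 - 56 * z ^+ 5
    <= (1 - z) ^+ 8.
  rewrite -subr_ge0 [leRHS](_ : _ = z ^+ 6 * (28 - 8 * z + z ^+ 2)); last by ring.
  by rewrite mulr_ge0 ?exprn_ge0//; nra.
have q0' : 0 <= 1 + 8 * z + (8 * z) ^+ 2 by nra.
apply: le_trans (ler_wpM2r q0' T5).
rewrite -subr_ge0 [leRHS](_ : _ =
  z ^+ 2 * ((28 - 344 * z + 1414 * z ^+ 2 - 3080 * z ^+ 3) + z ^+ 4 * (4032 - 3584 * z)));
  last by ring.
apply: mulr_ge0; first exact: exprn_ge0.
have h1 : 0 <= z ^+ 4 * (4032 - 3584 * z) by apply: mulr_ge0; [exact: exprn_ge0|lra].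
apply: addr_ge0 h1.
have w0 : 0 <= 1 / 8 - z by lra.
(* Taylor expansion at the endpoint 1/8, where all coefficients in powers of 1/8 - z are
   positive. *)
have -> : 28 - 344 * z + 1414 * z ^+ 2 - 3080 * z ^+ 3 =
  69 / 64 + 1079 / 8 * (1 / 8 - z) + 259 * (1 / 8 - z) ^+ 2
  + 3080 * (1 / 8 - z) ^+ 3 by field.
apply: addr_ge0; last by apply: mulr_ge0; [lra|exact: exprn_ge0].
apply: addr_ge0; last by apply: mulr_ge0; [lra|exact: exprn_ge0].
apply: addr_ge0; first by lra.
by apply: mulr_ge0; lra.
Qed.

(** For |y| <= 1, exp is at most 1 + y + y^2 and y^2 <= |y|^a; for |y| > 1, |y| <= |y|^a is enough.
    The linear term is kept apart because it vanishes in the mean for centred noise. *)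
Lemma expR_le_powR a y : 1 <= a <= 2 -> expR y <= y + expR (`|y| `^ a).
Proof.
move=> /andP[a1 a2]; have [y1|y1] := leP `|y| 1.
  apply: le_trans (expR_le_quadratic y1) _.
  suff : 1 + y ^+ 2 <= expR (`|y| `^ a) by lra.
  apply: le_trans (expR_ge1Dx _); rewrite lerD2l.
  have [->|y0] := eqVneq y 0; first by rewrite expr0n/= powR_ge0.
  rewrite -real_normK ?num_real// -powR_mulrn//.
  by apply: ger_powR => //; rewrite normr_gt0 y0.
have ya : `|y| <= `|y| `^ a by apply: le1r_powR => //; exact: ltW.
have [y0|y0] := leP 0 y.
  apply: (@le_trans _ _ (expR (`|y| `^ a))); last by rewrite lerDr.
  by rewrite ler_expR -{1}(ger0_norm y0).
have := expR_ge1Dx (`|y| `^ a).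
have : expR y <= 1 by rewrite -expR0 ler_expR ltW.
by move: ya; rewrite ltr0_norm//; lra.
Qed.

Lemma expR_convex_le s x : 0 <= s <= 1 -> expR (s * x) <= 1 - s + s * expR x.
Proof.
move=> /andP[s0 s1].
have := convex_expR (Itv01 s0 s1) (x : R^o) (0 : R^o).
rewrite !convRE/= mulr0 addr0 expR0 mulr1 => /le_trans; apply.
by rewrite addrC /unstable.onem.
Qed.

(** A pointwise form of E exp(s x) <= (E exp x)^s: when E exp x <= e, the bracket has mean at most
    1. *)
Lemma expR_tilt_le s x : 0 <= s <= 1 ->
  expR (s * x) <= expR s * (1 - s + s * (expR x / expR 1)).
Proof.
move=> s01; have := expR_convex_le (x - 1) s01.
rewrite mulrBr mulr1 !expRB ler_pdivrMr ?expR_gt0//.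
by rewrite [leRHS]mulrC.
Qed.

End ExpInequalities.

Section MeasurableVectors.
Context {R : realType} {n : nat} {d : measure_display} {T : measurableType d}.
Implicit Types u v : T -> 'rV[R]_n.
Local Notation measurable_vec u :=
  (forall j, measurable_fun [set: T] (fun t => u t 0 j)).

Lemma measurable_vec_borel u : measurable_fun [set: T] (u : T -> borel_rV R n) ->
  measurable_vec u.
Proof. by move=> mu_ j; exact: (measurableT_comp (measurable_coord j) mu_). Qed.

Lemma measurable_vecD u v : measurable_vec u -> measurable_vec v ->
  measurable_vec (fun t => u t + v t).
Proof. by move=> mu_ mv j; under eq_fun do rewrite mxE; exact: measurable_funD. Qed.

Lemma measurable_vecB u v : measurable_vec u -> measurable_vec v ->
  measurable_vec (fun t => u t - v t).
Proof. by move=> mu_ mv j; under eq_fun do rewrite !mxE; exact: measurable_funB. Qed.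

Lemma measurable_vecZ (a : R) u : measurable_vec u ->
  measurable_vec (fun t => a *: u t).
Proof.
by move=> mu_ j; under eq_fun do rewrite mxE; exact: measurable_funM.
Qed.

Lemma measurable_dot u v : measurable_vec u -> measurable_vec v ->
  measurable_fun [set: T] (fun t => dot (u t) (v t)).
Proof. by move=> mu_ mv; apply: measurable_sum => j; exact: measurable_funM. Qed.

Lemma measurable_enorm u : measurable_vec u ->
  measurable_fun [set: T] (fun t => enorm (u t)).
Proof.
move=> mu_; apply: (measurableT_comp (continuous_measurable_fun (@sqrt_continuous R))).
exact: measurable_dot.
Qed.

End MeasurableVectors.

Lemma integral_cst_probability {R : realType} d (T : measurableType d)
  (P : probability T R) (r : R) : (\int[P]_t r%:E = r%:E)%E.
Proof. by rewrite integral_cst// [X in (_ * X)%E](probability_setT P) mule1. Qed.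

(** * Measurability, centring and moment generating function of the oracle noise *)

Section Oracle.
Context {R : realType} {n : nat} {dX : measure_display} {Xi : measurableType dX}.
Variables (mu : probability Xi R) (G : 'rV[R]_n -> Xi -> 'rV[R]_n).
Hypothesis G_meas : measurable_fun [set: borel_rV R n * Xi]
     (fun p : borel_rV R n * Xi => G p.1 p.2 : borel_rV R n).

Lemma measurable_mean_oracle :
  measurable_fun [set: borel_rV R n] (mean_oracle mu G : borel_rV R n -> borel_rV R n).
Proof.
apply: measurable_borel_rV => j; under eq_fun do rewrite mxE.
apply: measurableT_comp; first exact: fine_measurable.
have mG : measurable_fun [set: borel_rV R n * Xi]
    (fun p : borel_rV R n * Xi => (G p.1 p.2 0 j)%:E).
  by apply/measurable_EFinP; exact: measurable_vec_borel.
rewrite unlock; under eq_fun do rewrite integralE.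
apply: emeasurable_funB.
- under eq_fun do under eq_integral do rewrite funeposE.
  have := @measurable_fun_fubini_tonelli_F _ _ (borel_rV R n) Xi R mu _
    (measurable_funepos mG) (fun p => funepos_ge0 _ p).
  by rewrite /fubini_F; under eq_fun do under eq_integral do rewrite funeposE.
- under eq_fun do under eq_integral do rewrite funenegE.
  have := @measurable_fun_fubini_tonelli_F _ _ (borel_rV R n) Xi R mu _
    (measurable_funeneg mG) (fun p => funeneg_ge0 _ p).
  by rewrite /fubini_F; under eq_fun do under eq_integral do rewrite funenegE.
Qed.

Lemma measurable_oracle_noise d (T : measurableType d) (y : T -> 'rV[R]_n) (s : T -> Xi) :
  measurable_fun [set: T] (y : T -> borel_rV R n) -> measurable_fun [set: T] s ->
  forall j, measurable_fun [set: T] (fun t => (G (y t) (s t) - mean_oracle mu G (y t)) 0 j).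
Proof.
move=> my ms; apply: measurable_vecB; apply: measurable_vec_borel.
  exact: (measurableT_comp G_meas (measurable_fun_pair my ms)).
exact: (measurableT_comp measurable_mean_oracle my).
Qed.

Lemma measurable_oracle_error d (T : measurableType d) (y : T -> 'rV[R]_n) (s : T -> Xi) :
  measurable_fun [set: T] (y : T -> borel_rV R n) -> measurable_fun [set: T] s ->
  measurable_fun [set: T] (fun t => oracle_error mu G (y t) (s t)).
Proof. by move=> my ms; apply: measurable_enorm; exact: measurable_oracle_noise. Qed.

Section AtPoint.
Variable x : 'rV[R]_n.
Hypothesis G_integrable : forall j, mu.-integrable [set: Xi] (fun s => (G x s 0 j)%:E).

Local Notation e s := (G x s - mean_oracle mu G x).

Let integrable_noise_coord j : mu.-integrable [set: Xi] (fun s => (e s 0 j)%:E).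
Proof.
under eq_fun do rewrite !mxE EFinB.
by apply: integrableB => //; exact: finite_measure_integrable_cst.
Qed.

Let mean_noise_coord j : (\int[mu]_s (e s 0 j)%:E = 0)%E.
Proof.
under eq_integral do rewrite !mxE EFinB.
rewrite integralB//; last exact: finite_measure_integrable_cst.
rewrite integral_cst_probability unlock.
have fin : (\int[mu]_s (G x s 0 j)%:E \is a fin_num)%E by exact: integrable_fin_num.
by rewrite fineK// subee.
Qed.

Lemma integrable_dot_noise v : mu.-integrable [set: Xi] (fun s => (dot (e s) v)%:E).
Proof.
under eq_fun do rewrite -sumEFin.
apply: integrable_sum => // j _; under eq_fun do rewrite EFinM.
exact: integrableZr.
Qed.

Lemma mean_dot_noise v : (\int[mu]_s (dot (e s) v)%:E = 0)%E.
Proof.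
under eq_integral do rewrite -sumEFin.
rewrite integral_sum//; last first.
  by move=> j; under eq_fun do rewrite EFinM; exact: integrableZr.
apply: big1 => j _; under eq_integral do rewrite EFinM.
by rewrite integralZr// mean_noise_coord mul0e.
Qed.

Let measurable_error : measurable_fun [set: Xi] (oracle_error mu G x).
Proof. exact: (@measurable_oracle_error _ Xi (fun=> x) id). Qed.

Section ExpMoment.
Variables (sigma alpha : R).
Hypotheses (sigma_gt0 : 0 < sigma) (alpha12 : 1 < alpha <= 2).
Hypothesis exp_moment :
  (\int[mu]_s (expR (oracle_error mu G x s `^ alpha / sigma `^ alpha))%:E <= (expR 1)%:E)%E.

Let q s := oracle_error mu G x s `^ alpha / sigma `^ alpha.

Let measurable_q : measurable_fun [set: Xi] q.
Proof.
apply: measurable_funM => //.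
exact: measurableT_comp (measurable_powR _) measurable_error.
Qed.

Lemma exp_moment_tilt (r : R) : 0 <= r <= 1 ->
  (\int[mu]_s (expR (r * q s))%:E <= (expR r)%:E)%E.
Proof.
move=> r01; have [r0 r1] := andP r01.
have mq : measurable_fun [set: Xi] (fun s => (expR (q s))%:E).
  by apply/measurable_EFinP; exact: measurableT_comp.
apply: (@le_trans _ _ (\int[mu]_s ((expR r * (1 - r))%:E
    + (expR r * (r / expR 1))%:E * (expR (q s))%:E))%E).
  apply: ge0_le_integral => //.
  - by apply/measurable_EFinP; apply: measurableT_comp => //; exact: measurable_funM.
  - by apply: emeasurable_funD => //; exact: measurable_funeM.
  - move=> s _; rewrite -EFinM -EFinD lee_fin.
    apply: le_trans (expR_tilt_le _ r01) _.
    by rewrite le_eqVlt; apply/orP; left; apply/eqP; ring.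
rewrite ge0_integralD//.
- rewrite integral_cst_probability ge0_integralZl_EFin//.
  + apply: (@le_trans _ _ ((expR r * (1 - r))%:E
      + (expR r * (r / expR 1))%:E * (expR 1)%:E)%E).
      rewrite leeD2l// lee_wpmul2l// lee_fin.
      by rewrite mulr_ge0 ?expR_ge0// divr_ge0 ?expR_ge0.
    rewrite -EFinM -EFinD lee_fin -mulrA divfK ?gt_eqF ?expR_gt0//.
    by rewrite -mulrDr subrK mulr1.
  + by rewrite mulr_ge0 ?expR_ge0// divr_ge0 ?expR_ge0.
- by move=> s _; rewrite lee_fin mulr_ge0 ?expR_ge0// subr_ge0.
- by move=> s _; rewrite -EFinM lee_fin !mulr_ge0 ?invr_ge0 ?expR_ge0.
- exact: measurable_funeM.
Qed.

(** With Y = <e, v> / (D sigma) one has |Y|^alpha <= q. For lam <= 1, exp(lam Y) <= lam Y +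
    exp(lam^alpha q), where the first term has mean zero and the tilt r = lam^alpha <= 1 is
    admissible for the second. *)
Lemma mgf_noise v (D lam : R) : 0 < D -> enorm v <= D -> 0 <= lam ->
  lam <= 1 \/ alpha = 2 ->
  (\int[mu]_s (expR (lam / (D * sigma) * dot (e s) v))%:E <= (expR (lam `^ alpha))%:E)%E.
Proof.
move=> D0 vD lam0 lam1.
have [a1 a2] := andP alpha12; have a0 : 0 <= alpha by lra.
have Ds0 : 0 < D * sigma by rewrite mulr_gt0.
pose Y s := dot (e s) v / (D * sigma).
have Yq s : `|Y s| `^ alpha <= q s.
  rewrite /q -powR_inv1 ?powR_ge0// powRAC powR_inv1 ?(ltW sigma_gt0)//.
  rewrite -powRM ?invr_ge0 ?(ltW sigma_gt0) ?enorm_ge0//.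
  apply: ge0_ler_powR; rewrite ?nnegrE ?divr_ge0 ?enorm_ge0 ?(ltW sigma_gt0)//.
  rewrite normrM normfV (gtr0_norm Ds0) ler_pdivrMr// mulrCA divfK ?gt_eqF//.
  apply: le_trans (norm_dot_le _ _) _.
  by rewrite mulrC ler_wpM2r// enorm_ge0.
have mdot : measurable_fun [set: Xi] (fun s => dot (e s) v).
  apply: measurable_dot => //.
  exact: (@measurable_oracle_noise _ Xi (fun=> x) id).
have mlhs : measurable_fun [set: Xi] (fun s => (expR (lam / (D * sigma) * dot (e s) v))%:E).
  by apply/measurable_EFinP; apply: measurableT_comp => //; exact: measurable_funM.
have mexp r : measurable_fun [set: Xi] (fun s => (expR (r * q s))%:E).
  by apply/measurable_EFinP; apply: measurableT_comp => //; exact: measurable_funM.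
have lamE s : lam / (D * sigma) * dot (e s) v = lam * Y s by rewrite /Y; ring.
have [l1|l1] := leP lam 1.
  have r01 : 0 <= lam `^ alpha <= 1.
    rewrite powR_ge0/=; have [->|l0] := eqVneq lam 0.
      by rewrite powR0// gt_eqF//; lra.
    apply: (le_trans (ge1r_powR _ (ltW a1))); last exact: l1.
    by rewrite l1 lt_neqAle eq_sym l0 lam0.
  apply: le_trans (exp_moment_tilt r01).
  have iexp : mu.-integrable [set: Xi] (fun s => (expR (lam `^ alpha * q s))%:E).
    apply/integrableP; split=> //.
    under eq_integral do rewrite gee0_abs ?lee_fin ?expR_ge0//.
    exact: le_lt_trans (exp_moment_tilt r01) (ltry _).
  have ilin : mu.-integrable [set: Xi] (fun s => (lam / (D * sigma))%:E * (dot (e s) v)%:E)%E.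
    exact/integrableZl/integrable_dot_noise.
  rewrite -[leRHS]add0e -{1}(mule0 (lam / (D * sigma))%:E) -(mean_dot_noise v).
  rewrite -integralZl//; last exact: integrable_dot_noise.
  rewrite -integralD//; apply: ge0_le_integral => //.
  - by apply: emeasurable_funD => //; apply: measurable_funeM; exact/measurable_EFinP.
  move=> s _; rewrite -EFinM -EFinD lee_fin lamE.
  have a12 : 1 <= alpha <= 2 by rewrite a2 ltW.
  apply: le_trans (expR_le_powR _ a12) _.
  rewrite lerD2l ler_expR normrM (ger0_norm lam0) powRM//.
  by rewrite ler_wpM2l ?powR_ge0.
case: lam1 => [|alpha2]; first by rewrite leNgt l1.
(* For lam > 1 and alpha = 2: lam Y <= lam^2/2 + Y^2/2, and the tilt 1/2 contributes exp(1/2) <=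
   exp(lam^2/2). *)
have h01 : 0 <= (2^-1 : R) <= 1 by rewrite invr_ge0 invf_le1//; lra.
apply: (@le_trans _ _ (\int[mu]_s ((expR (lam ^+ 2 / 2))%:E * (expR (2^-1 * q s))%:E))%E).
  apply: ge0_le_integral => //.
  - exact: measurable_funeM.
  move=> s _; rewrite -EFinM lee_fin lamE -expRD ler_expR.
  have := Yq s; rewrite alpha2 powR_mulrn// real_normK ?num_real// => H.
  have : 0 <= (lam - Y s) ^+ 2 by rewrite sqr_ge0.
  lra.
rewrite ge0_integralZl_EFin ?expR_ge0//.
apply: (@le_trans _ _ ((expR (lam ^+ 2 / 2))%:E * (expR 2^-1)%:E)%E).
  by rewrite lee_wpmul2l ?lee_fin ?expR_ge0// exp_moment_tilt.
rewrite -EFinM lee_fin -expRD ler_expR alpha2 powR_mulrn//.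
have : 1 <= lam ^+ 2 by rewrite exprn_ege1// ltW.
lra.
Qed.

End ExpMoment.
End AtPoint.
End Oracle.

(** * Young inequalities *)

Section PowerInequalities.
Context {R : realType}.
Implicit Types a b t u w nu e alpha eta gam : R.

(** The degenerate weight b = 1 is included since it occurs as b = alpha - 1 when alpha = 2. *)
Lemma powR_AMGM b u w : 0 < b <= 1 -> 0 <= u -> 0 <= w ->
  u `^ b * w `^ (1 - b) <= b * u + (1 - b) * w.
Proof.
move=> /andP[b0]; rewrite le_eqVlt => /predU1P[-> u0 w0|b1 u0 w0].
  by rewrite subrr powRr0 powRr1// mulr1 mul1r mul0r addr0.
have b1' : 0 < 1 - b by rewrite subr_gt0.
have := @conjugate_powR R (u `^ b) (w `^ (1 - b)) b^-1 (1 - b)^-1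
  (powR_ge0 _ _) (powR_ge0 _ _).
rewrite !invr_gt0 !invrK -!powRrM !mulfV ?gt_eqF// !powRr1// => /(_ b0 b1').
by rewrite subrKC [u * _]mulrC [w * _]mulrC; apply.
Qed.

Lemma Lsmooth_ge0 (Hf : R) nu e : 0 <= Lsmooth Hf nu e.
Proof. by rewrite mulr_ge0// powR_ge0. Qed.

(** AM-GM for L t^2 and e/4 with weights (1 + nu)/2 and (1 - nu)/2; [Lsmooth] is the L for which the
    geometric mean equals Hf t^(1 + nu). *)
Lemma Holder_le_quadratic (Hf : R) nu e t : 0 <= Hf -> 0 < nu < 1 -> 0 < e -> 0 <= t ->
  Hf * t `^ nu * t <= Lsmooth Hf nu e * t ^+ 2 + e / 8.
Proof.
move=> H0 /andP[nu0 nu1] e0 t0.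
have Ln0 := Lsmooth_ge0 Hf nu e.
have q4 : 0 <= 4 / e by rewrite divr_ge0// ltW.
have e4 : 0 <= e / 4 by rewrite divr_ge0// ltW.
have b01 : 0 < (1 + nu) / 2 <= 1 by apply/andP; split; lra.
have := powR_AMGM b01 (mulr_ge0 Ln0 (powR_ge0 t 2)) e4.
have -> : 1 - (1 + nu) / 2 = (1 - nu) / 2 by field.
rewrite (powRM _ Ln0 (powR_ge0 t 2)) /Lsmooth (powRM _ (powR_ge0 _ _) (powR_ge0 _ _)).
rewrite -!powRrM.
have -> : 2 / (1 + nu) * ((1 + nu) / 2) = 1 by field; rewrite gt_eqF//; lra.
have -> : (1 - nu) / (1 + nu) * ((1 + nu) / 2) = (1 - nu) / 2.
  by field; rewrite gt_eqF//; lra.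
have -> : 2 * ((1 + nu) / 2) = 1 + nu by field.
rewrite powRr1// (powR_mulrn 2 t0).
set A := Hf `^ _ * _ `^ _ * _.
have -> : Hf * (4 / e) `^ ((1 - nu) / 2) * t `^ (1 + nu) * (e / 4) `^ ((1 - nu) / 2)
   = Hf * t `^ nu * t.
  rewrite mulrAC -[X in X * _ = _]mulrA -powRM// mulf_div (mulrC 4) divff ?mulf_neq0 ?gt_eqF//.
  rewrite powR1 mulr1 -mulrA; congr (_ * _).
  have [->|tn0] := eqVneq t 0; first by rewrite mulr0 powR0// gt_eqF//; lra.
  by rewrite powRD ?tn0 ?implybT// powRr1// mulrC.
have A0 : 0 <= A by rewrite !mulr_ge0 ?powR_ge0 ?sqr_ge0.
move=> /le_trans; apply; nra.
Qed.

Section Noise.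
Variables (alpha sigma D eps : R).
Hypotheses (alpha12 : 1 < alpha <= 2) (sigma_gt0 : 0 < sigma).
Hypotheses (D_gt0 : 0 < D) (eps_gt0 : 0 < eps).

(** This is Lambda^2 without one factor alpha - 1, which reappears as the weight of the AM-GM
    inequality. *)
Definition noise_scale : R := 8 * (alpha - 1)
  * (sigma / alpha) `^ (alpha / (alpha - 1))
  * (8 * D / eps) `^ ((2 - alpha) / (alpha - 1)).

(* Chosen so that, after Young's inequality with exponents 1/(alpha-1) and
   1/(2-alpha), its mean contribution is eta Lambda^2 + gam eps/8. *)
Definition noise_weight (eta gam : R) : R :=
  (eta * noise_scale) `^ (alpha - 1) * (gam * eps / 8) `^ (2 - alpha).

Let a1 : 0 < alpha - 1. Proof. by case/andP: alpha12 => *; lra. Qed.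
Let a0 : 0 < alpha. Proof. by case/andP: alpha12 => *; lra. Qed.
Let b0 : 0 <= 2 - alpha. Proof. by case/andP: alpha12 => *; lra. Qed.

Lemma noise_scale_gt0 : 0 < noise_scale.
Proof. by rewrite /noise_scale !mulr_gt0 ?powR_gt0 ?divr_gt0// mulr_gt0. Qed.

Lemma sqr_Lambda : Lambda alpha sigma D eps ^+ 2 = (alpha - 1) * noise_scale.
Proof.
rewrite /Lambda sqr_sqrtr; first by rewrite /noise_scale; ring.
by do 2 rewrite mulr_ge0 ?powR_ge0//; rewrite mulr_ge0 ?sqr_ge0.
Qed.

Lemma Lambda_gt0 : 0 < Lambda alpha sigma D eps.
Proof.
rewrite lt_neqAle sqrtr_ge0 andbT eq_sym -sqrf_eq0 sqr_Lambda mulf_eq0.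
by rewrite !gt_eqF// noise_scale_gt0.
Qed.

(** [C] is absorbed entirely into the first argument of the AM-GM, which raises it to the power
    1/(alpha - 1). The value 1 yields [Lambda] and the value 1 + ln(2/delta) yields
    [Lambda_tilde]. *)
Lemma noise_weight_le (C : R) eta gam : 0 < C -> 0 < eta -> 0 < gam ->
  C * noise_weight eta gam <=
    eta * (C `^ (alpha - 1)^-1 * Lambda alpha sigma D eps ^+ 2) + gam * eps / 8.
Proof.
move=> C0 eta0 gam0; have s0 := noise_scale_gt0.
have ge0 : 0 < gam * eps / 8 by rewrite divr_gt0// mulr_gt0.
have es0 : 0 <= eta * noise_scale by rewrite mulr_ge0// ltW.
have -> : C * noise_weight eta gam =
    (C `^ (alpha - 1)^-1 * (eta * noise_scale)) `^ (alpha - 1)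
     * (gam * eps / 8) `^ (1 - (alpha - 1)).
  rewrite (powRM _ (powR_ge0 _ _) es0) -powRrM mulVf ?gt_eqF// powRr1 ?(ltW C0)// -mulrA.
  by rewrite (_ : 1 - (alpha - 1) = 2 - alpha)//; ring.
have a01 : 0 < alpha - 1 <= 1 by case/andP: alpha12 => *; apply/andP; split; lra.
have U0 : 0 <= C `^ (alpha - 1)^-1 * (eta * noise_scale).
  by rewrite mulr_ge0 ?powR_ge0.
apply: le_trans (powR_AMGM a01 U0 (ltW ge0)) _.
rewrite sqr_Lambda; apply: lerD.
  by rewrite le_eqVlt; apply/orP; left; apply/eqP; ring.
by apply: ler_piMl; [exact: ltW|move: a1; lra].
Qed.

(** Young's inequality for (c a)(t / c) with exponents alpha and q. As q = 2 + r with r >= 0, the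
    bound t <= gam D reduces t^q to a multiple of t^2. *)
Lemma noise_Young eta gam a t : 0 < eta -> 0 < gam -> 0 <= a ->
  0 <= t <= gam * D ->
  a * t <= noise_weight eta gam * (a `^ alpha / sigma `^ alpha) + t ^+ 2 / (8 * eta).
Proof.
move=> eta0 gam0 ha /andP[t0 tD]; have s0 := noise_scale_gt0.
have gd0 : 0 < gam * D by rewrite mulr_gt0.
have ge0 : 0 < gam * eps / 8 by rewrite divr_gt0// mulr_gt0.
have k0 : 0 < noise_weight eta gam.
  by rewrite mulr_gt0 ?powR_gt0// mulr_gt0.
set k := noise_weight eta gam in k0 *.
pose q := alpha / (alpha - 1); pose r := (2 - alpha) / (alpha - 1).
have q0 : 0 < q by rewrite divr_gt0.
(* Determined by (c a)^alpha / alpha = k a^alpha / sigma^alpha. *)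
pose c := (alpha * k) `^ alpha^-1 / sigma.
have c0 : 0 < c by rewrite divr_gt0// powR_gt0// mulr_gt0.
have ac : (c * a) `^ alpha / alpha = k * (a `^ alpha / sigma `^ alpha).
  rewrite /c powRM ?(ltW c0)// powRM ?invr_ge0 ?powR_ge0 ?(ltW sigma_gt0)//.
  rewrite -powRrM mulVf ?gt_eqF// powRr1; last by rewrite mulr_ge0// ltW.
  rewrite -(powR_inv1 (ltW sigma_gt0)) powRAC powR_inv1 ?powR_ge0//.
  by field; rewrite !gt_eqF// powR_gt0.
have tc : (t / c) `^ q / q <= t ^+ 2 / (8 * eta).
  have tq : t `^ q <= t ^+ 2 * (gam * D) `^ r.
    have [->|tn0] := eqVneq t 0; first by rewrite powR0 ?gt_eqF// expr0n/= mul0r.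
    rewrite (_ : q = 2 + r); last by rewrite /q /r; field; rewrite gt_eqF.
    rewrite powRD ?tn0 ?implybT// powR_mulrn// ler_wpM2l ?sqr_ge0//.
    by apply: ge0_ler_powR; rewrite ?nnegrE ?divr_ge0// ltW.
  (* This identity dictates the constants in [noise_scale]: the factor (gam D)^r cancels and exactly
     1/(8 eta) is left in front of t^2. *)
  have cq : q * c `^ q = 8 * eta * (gam * D) `^ r.
    rewrite /c powRM ?invr_ge0 ?powR_ge0 ?(ltW sigma_gt0)// -powRrM.
    rewrite (_ : alpha^-1 * q = (alpha - 1)^-1); last first.
      by rewrite /q; field; rewrite !gt_eqF.
    rewrite powRM ?(ltW a0) ?(ltW k0)// /k /noise_weight.
    rewrite powRM ?powR_ge0// -!powRrM mulfV ?gt_eqF// powRr1; last first.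
      by rewrite mulr_ge0// ltW.
    rewrite -/r /noise_scale -/q -/r.
    have -> : (gam * D) `^ r = (8 * D / eps) `^ r * (gam * eps / 8) `^ r.
      rewrite -powRM ?divr_ge0 ?mulr_ge0 ?(ltW D_gt0) ?(ltW eps_gt0) ?(ltW gam0)//.
      by congr powR; field; rewrite gt_eqF.
    have -> : (sigma / alpha) `^ q = sigma `^ q / (alpha `^ (alpha - 1)^-1 * alpha).
      rewrite powRM ?invr_ge0 ?(ltW sigma_gt0) ?(ltW a0)//; congr (_ * _).
      rewrite -(powR_inv1 (ltW a0)) powRAC powR_inv1 ?powR_ge0//; congr (_ ^-1).
      rewrite (_ : q = (alpha - 1)^-1 + 1); last by rewrite /q; field; rewrite gt_eqF.
      by rewrite powRD ?powRr1 ?(ltW a0)// (gt_eqF a0) implybT.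
    rewrite -(powR_inv1 (ltW sigma_gt0)) powRAC powR_inv1 ?powR_ge0// /q.
    by field; rewrite !gt_eqF ?powR_gt0.
  rewrite powRM ?invr_ge0 ?(ltW c0)// -(powR_inv1 (ltW c0)) powRAC.
  rewrite powR_inv1 ?powR_ge0// -mulrA -invfM [_ * q]mulrC cq.
  rewrite ler_pdivrMr ?mulr_gt0 ?powR_gt0//.
  apply: le_trans tq _; rewrite mulrA divfK// mulf_neq0// gt_eqF//.
rewrite -ac; have -> : a * t = (c * a) * (t / c) by field; rewrite gt_eqF.
apply: le_trans (lerD (lexx _) tc).
apply: conjugate_powR => //; first by rewrite mulr_ge0// ltW.
  by rewrite divr_ge0// ltW.
by rewrite /q; field; rewrite !gt_eqF.
Qed.

End Noise.
End PowerInequalities.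

(** * One step of the method *)

Section Descent.
Context {R : realType} {n : nat}.
Variables (f h : 'rV[R]_n -> \bar R).
Hypotheses (f_proper : proper_function f) (h_proper : proper_function h).
Hypotheses (h_lsc : lower_semicontinuous h).
Hypothesis h_convex : econvex_function h.
Hypothesis dom_sub : effective_domain h `<=` effective_domain f.
Hypothesis h_bounded : bounded_set (effective_domain h).
Variables (Lf Hf Mf nu : R).
Hypotheses (Hf_ge0 : 0 <= Hf) (nu01 : 0 < nu < 1).
Hypothesis f_subgrad : forall x y gx gy : 'rV[R]_n,
  effective_domain f x -> effective_domain f y ->
  subdifferential f x gx -> subdifferential f y gy ->
  enorm (gy - gx) <= Lf * enorm (y - x) + Hf * enorm (y - x) `^ nu + Mf.
Variable grad : 'rV[R]_n -> 'rV[R]_n.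
Hypothesis grad_sub : forall x, effective_domain f x -> subdifferential f x (grad x).

Let fr x := fine (f x).
Let hr x := fine (h x).

Lemma subgradient_le x z g : effective_domain f x -> effective_domain f z ->
  subdifferential f x g -> fr x + dot g (z - x) <= fr z.
Proof.
move=> fx fz /(_ z).
rewrite -(fineK (dom_fin_num f_proper fx)) -(fineK (dom_fin_num f_proper fz)).
by rewrite -EFinD lee_fin.
Qed.

(** The subgradient inequality is taken at y and grad y is then compared with grad x. This needs no
    integration along the segment; the quadratic coefficient is L instead of L/2. *)
Lemma smooth_upper_bound x y e : effective_domain f x -> effective_domain f y -> 0 < e ->
  fr y <= fr x + dot (grad x) (y - x)
    + (Lf + Lsmooth Hf nu e) * enorm (y - x) ^+ 2 + Mf * enorm (y - x) + e / 8.
Proof.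
move=> fx fy e0; set t := enorm (y - x).
have t0 : 0 <= t by exact: enorm_ge0.
have := subgradient_le fy fx (grad_sub fy).
have := Cauchy_Schwarz (grad y - grad x) (y - x).
have := f_subgrad fx fy (grad_sub fx) (grad_sub fy).
rewrite -/t -(opprB y x) [dot (grad y) (- _)]dotC dotNl dotBl (dotC (y - x)).
move=> /(ler_wpM2r t0) H1 H2 H3.
have := Holder_le_quadratic Hf_ge0 nu01 e0 t0; nra.
Qed.

Variables (alpha sigma D eps : R).
Hypotheses (alpha12 : 1 < alpha <= 2) (sigma_gt0 : 0 < sigma).
Hypotheses (D_gt0 : 0 < D) (eps_gt0 : 0 < eps).
Hypothesis diam : forall x y, effective_domain h x -> effective_domain h y ->
  enorm (x - y) <= D.

Lemma prox_subgradient_step (eta gam eps' : R) x z G u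
  (y := (1 - gam) *: z + gam *: x)
  (x' := prox h (eta / gam) (x - (eta / gam) *: G))
  (z' := (1 - gam) *: z + gam *: x') :
  0 < eta -> 0 < gam <= 1 -> 0 < eps' ->
  4 * eta * (Lf + Lsmooth Hf nu eps') <= 1 ->
  effective_domain h x -> effective_domain h z -> effective_domain h u ->
  fr z' + hr z' - (fr u + hr u) <= (1 - gam) * (fr z + hr z - (fr u + hr u))
    + gam ^+ 2 / (2 * eta) * (enorm (u - x) ^+ 2 - enorm (u - x') ^+ 2)
    + (eps' / 8 + 2 * eta * Mf ^+ 2
       + noise_weight alpha sigma D eps eta gam
         * (enorm (G - grad y) `^ alpha / sigma `^ alpha)
       + gam * dot (G - grad y) (u - x)).
Proof.
move=> eta0 /andP[g0 g1] e0 etaL hx hz hu.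
have eg0 : 0 < eta / gam by rewrite divr_gt0.
have hx' : effective_domain h x'.
  exact: (prox_dom _ h_proper h_lsc h_bounded).
have g01 : 0 < gam <= 1 by rewrite g0.
have conv a : effective_domain h a -> effective_domain h ((1 - gam) *: z + gam *: a)
    /\ hr ((1 - gam) *: z + gam *: a) <= (1 - gam) * hr z + gam * hr a.
  move=> ha; have := econvex_dom h_convex h_proper g01 ha hz.
  by rewrite (addrC (gam *: a)) (addrC (gam * _)).
have [hy _] := conv x hx; have [hz' hz'le] := conv x' hx'.
rewrite -/y in hy; rewrite -/z' in hz' hz'le.
have fy := dom_sub hy; have fz := dom_sub hz.
have fz' := dom_sub hz'; have fu := dom_sub hu.
set g := grad y; set e := G - g.
have zy : z' - y = gam *: (x' - x).
  by apply/rowP => j; rewrite !mxE; ring.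
set t := enorm (z' - y).
have tE : t = gam * enorm (x' - x) by rewrite /t zy enormZ gtr0_norm.
have t0 : 0 <= t by exact: enorm_ge0.
have tD : 0 <= t <= gam * D by rewrite t0 tE ler_pM2l// diam.
have S1 := smooth_upper_bound fy fz' e0; rewrite -/g -/t in S1.
have S2 := subgradient_le fy fz (grad_sub fy); rewrite -/g in S2.
have S3 := subgradient_le fy fu (grad_sub fy); rewrite -/g in S3.
have S4 := prox_three_point h_proper h_lsc h_convex eg0 h_bounded x G hu.
rewrite -/x' -/(hr x') -/(hr u) in S4.
(* The first two terms are absorbed by convexity of f towards z and u, the third by the prox
   inequality. *)
have gdot : dot g (z' - y) = (1 - gam) * dot g (z - y) + gam * dot g (u - y)
    + gam * dot g (x' - u).
  rewrite -!dotZr -!dotDr; congr dot.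
  by apply/rowP => j; rewrite !mxE; ring.
(* Splitting at x separates a term whose vector u - x does not involve the current sample, so that
   it averages to zero, from one bounded by |e| t. *)
have edot : dot g (x' - u) + dot G (u - x') = dot e (u - x) + dot e (x - x').
  rewrite -(opprB u x') [dot g (- _)]dotC dotNl (dotC _ g) addrC -dotBl -dotDr.
  by congr dot; rewrite subrKA.
have ecs : gam * dot e (x - x') <= enorm e * t.
  by rewrite tE mulrCA ler_pM2l// (enorm_sub x') Cauchy_Schwarz.
have N := noise_Young alpha12 sigma_gt0 D_gt0 eps_gt0 eta0 g0 (enorm_ge0 e) tD.
have S5 : gam * hr x' <= gam * (hr u + dot G (u - x'))
   + gam ^+ 2 / (2 * eta) * (enorm (u - x) ^+ 2 - enorm (u - x') ^+ 2)
   - t ^+ 2 / (2 * eta).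
  apply: le_trans (ler_wpM2l (ltW g0) S4) _.
  rewrite le_eqVlt; apply/orP; left; apply/eqP.
  by rewrite tE; field; rewrite !gt_eqF.
have S6 : (Lf + Lsmooth Hf nu eps') * t ^+ 2 <= t ^+ 2 / (4 * eta).
  rewrite mulrC ler_wpM2l ?sqr_ge0// -div1r ler_pdivlMr ?mulr_gt0//.
  by rewrite mulrC.
have S7 : Mf * t <= 2 * eta * Mf ^+ 2 + t ^+ 2 / (8 * eta).
  have : 0 <= 2 * eta * (Mf - t / (4 * eta)) ^+ 2.
    by rewrite mulr_ge0 ?sqr_ge0// mulr_ge0// ltW.
  rewrite (_ : 2 * eta * _ = 2 * eta * Mf ^+ 2 + t ^+ 2 / (8 * eta) - Mf * t) ?subr_ge0//.
  by field; rewrite gt_eqF.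
(* The negative quadratic term pays, in this order, for the smooth part, for one of [Mf] and the
   noise, and for the other. *)
have S8 : t ^+ 2 / (2 * eta) = t ^+ 2 / (4 * eta) + t ^+ 2 / (8 * eta) + t ^+ 2 / (8 * eta).
  by field; rewrite gt_eqF.
have S2' : (1 - gam) * (fr y + dot g (z - y)) <= (1 - gam) * fr z.
  by rewrite ler_wpM2l// subr_ge0.
have S3' : gam * (fr y + dot g (u - y)) <= gam * fr u by rewrite ler_pM2l.
have edot' := congr1 ( *%R gam) edot.
move: S1 S2' S3' S5 S6 S7 N hz'le ecs edot'; rewrite gdot S8 !mulrDr; lra.
Qed.

End Descent.

(** * Step size arithmetic *)

Section StepSizeBudget.
Context {R : realType}.
Implicit Types (a b c e D S M La eps eta k Lf Hf nu : R).

(** The inverse of the minimum is the larger of a and 1/b, which is estimated by their sum so that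
    later bounds need no case distinction. For a = 0 the convention 1/0 = +oo leaves b. *)
Lemma min_invP a b : 0 <= a -> 0 < b ->
  [/\ 0 < min_inv a b, min_inv a b * a <= 1, min_inv a b <= b
    & (min_inv a b)^-1 <= a + b^-1].
Proof.
move=> a0 b0; have bi0 : 0 < b^-1 by rewrite invr_gt0.
rewrite /min_inv; have [->|an0] := eqVneq a 0.
  by rewrite inve0 minEge leey /= mulr0 add0r; split.
have ap : 0 < a by rewrite lt_neqAle eq_sym an0.
have ai0 : 0 < a^-1 by rewrite invr_gt0.
rewrite inver (negPf an0) -EFin_min /=.
have [ab|ba] := leP a^-1 b.
  by split=> //; [rewrite mulVf|rewrite invrK lerDl ltW].
split=> //; last by rewrite lerDr ltW.
by rewrite -ler_pdivlMr// div1r ltW.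
Qed.

Lemma Lsmooth_div Hf nu eps k : 0 < k -> 0 < eps ->
  Lsmooth Hf nu (eps / k) = Lsmooth Hf nu eps * k `^ ((1 - nu) / (1 + nu)).
Proof.
move=> k0 e0; rewrite /Lsmooth -mulrA -powRM ?divr_ge0 ?(ltW k0) ?(ltW e0)//.
by congr (_ * powR _ _); field; rewrite !gt_eqF.
Qed.

(** Passing from eps to eps / k multiplies [Lsmooth] by k^((1-nu)/(1+nu)), and (1+3nu)/(1+nu) is
    what this exponent lacks to 2. *)
Lemma Lsmooth_budget Hf nu eps D k c : 0 < nu < 1 -> 0 < k -> 0 < eps -> 0 < c ->
  ((c * D ^+ 2 * Lsmooth Hf nu eps / eps) `^ ((1 + nu) / (1 + 3 * nu)) <= k) ->
  c * D ^+ 2 * Lsmooth Hf nu (eps / k) <= eps * k ^+ 2.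
Proof.
move=> /andP[nu0 nu1] k0 e0 c0; have L0 := Lsmooth_ge0 Hf nu eps.
set X := c * D ^+ 2 * Lsmooth Hf nu eps / eps.
have X0 : 0 <= X.
  by rewrite divr_ge0 ?(ltW e0)//; apply: mulr_ge0 => //; rewrite pmulr_rge0 ?sqr_ge0.
have p0 : 0 < 1 + nu by lra.
have p1 : 0 < 1 + 3 * nu by lra.
have q0 : 0 <= (1 + 3 * nu) / (1 + nu) by rewrite divr_ge0// ltW.
move=> /(ge0_ler_powR q0); rewrite !nnegrE powR_ge0 (ltW k0) => /(_ isT isT).
rewrite -powRrM (_ : _ / _ * _ = 1); last by field; rewrite !gt_eqF.
rewrite powRr1// => Xk.
rewrite Lsmooth_div// mulrA.
have -> : c * D ^+ 2 * Lsmooth Hf nu eps = eps * X.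
  by rewrite /X; field; rewrite gt_eqF.
rewrite -mulrA ler_wpM2l ?(ltW e0)//.
apply: le_trans (ler_wpM2r (powR_ge0 _ _) Xk) _.
rewrite -powRD; last by rewrite (gt_eqF k0) implybT.
rewrite (_ : _ + _ = 2%:R); last by field; rewrite gt_eqF.
by rewrite powR_mulrn// ltW.
Qed.

Lemma sqrt_budget Lf eps D k c : 0 <= Lf -> 0 < k -> 0 < eps -> 0 < c ->
  Num.sqrt (c * D ^+ 2 * Lf / eps) <= k -> c * D ^+ 2 * Lf <= eps * k ^+ 2.
Proof.
move=> L0 k0 e0 c0 H; rewrite [leRHS]mulrC -ler_pdivrMr//.
have X0 : 0 <= c * D ^+ 2 * Lf / eps.
  by rewrite divr_ge0 ?(ltW e0)//; apply: mulr_ge0 => //; rewrite pmulr_rge0 ?sqr_ge0.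
by rewrite -[leLHS]sqr_sqrtr// lerXn2r ?nnegrE ?sqrtr_ge0// ltW.
Qed.

(** Shares of eps: 1/6 each for [Lf] and [L] and 1/8 for 1/b in the distance term, 1/12 for
    smoothing, 1/8 for M and La, and 1/8 left by the noise weights. The sum 19/24 is below 7/8; the
    last eighth is reserved for the martingale. *)
Lemma stepsize_budget Lf L M La D eps eta b k :
  0 <= Lf -> 0 <= L -> 0 <= M -> 0 < D -> 0 < eps -> 2 <= k -> 0 < b ->
  0 < eta -> eta <= b -> eta^-1 <= 4 * (Lf + L) + b^-1 ->
  48 * D ^+ 2 * Lf <= eps * k ^+ 2 -> 48 * D ^+ 2 * L <= eps * k ^+ 2 ->
  16 * D ^+ 2 <= eps * (k + 1) ^+ 2 * b ->
  16 * b * (k + 2) * (M ^+ 2 + La ^+ 2) <= 3 * eps ->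
  2 / eta * (k / (k + 1)) * D ^+ 2
    + k * (k + 1) * (k + 2) / 3 * (eps / k / 8 + 2 * eta * M ^+ 2)
    + k * (k + 1) * (k + 2) / 3 * (eta * La ^+ 2)
    + eps / 8 * (k * (k + 1)) <= 7 / 8 * eps * (k * (k + 1)).
Proof.
move=> Lf0 L0 M0 D0 e0 k2 b0 eta0 etab etai HLf HL Hb1 Hb2.
have k0 : 0 < k by lra.
have k10 : 0 < k + 1 by lra.
have kk0 : 0 < k * (k + 1) by rewrite mulr_gt0.
have kk : k ^+ 2 <= (k + 1) ^+ 2 by nra.
have T1 : 2 / eta * (k / (k + 1)) * D ^+ 2 <= (1 / 3 + 1 / 8) * eps * (k * (k + 1)).
  apply: (@le_trans _ _ (2 * (4 * (Lf + L) + b^-1) * (k / (k + 1)) * D ^+ 2)).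
    rewrite ler_wpM2r ?sqr_ge0// ler_wpM2r//; first by rewrite divr_ge0// ltW.
    by rewrite ler_wpM2l.
  have -> : 2 * (4 * (Lf + L) + b^-1) * (k / (k + 1)) * D ^+ 2 =
      (8 * D ^+ 2 * Lf + 8 * D ^+ 2 * L + 2 * D ^+ 2 / b) * (k / (k + 1)).
    by field; rewrite !gt_eqF.
  have -> : (1 / 3 + 1 / 8) * eps * (k * (k + 1)) =
      (1 / 3 + 1 / 8) * (eps * (k + 1) ^+ 2) * (k / (k + 1)).
    by field; rewrite gt_eqF.
  rewrite ler_wpM2r//; first by rewrite divr_ge0// ltW.
  have : eps * k ^+ 2 <= eps * (k + 1) ^+ 2 by rewrite ler_pM2l.
  have : 2 * D ^+ 2 / b <= eps * (k + 1) ^+ 2 / 8 by rewrite ler_pdivrMr//; lra.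
  lra.
have T2 : eta * ((k + 2) * (M ^+ 2 + La ^+ 2)) <= 3 / 16 * eps.
  apply: (@le_trans _ _ (b * ((k + 2) * (M ^+ 2 + La ^+ 2)))).
    by rewrite ler_wpM2r// mulr_ge0 ?addr_ge0 ?sqr_ge0//; lra.
  by move: Hb2; rewrite !mulrA; lra.
have T3 : k * (k + 1) * (k + 2) / 3 * (eps / k / 8 + 2 * eta * M ^+ 2 + eta * La ^+ 2)
    <= (1 / 12 + 1 / 8) * eps * (k * (k + 1)).
  rewrite [leRHS]mulrC [X in X <= _](_ : _ = k * (k + 1) * ((k + 2) / k * eps / 24 +
    (eta * ((k + 2) * (2 * M ^+ 2 + La ^+ 2))) / 3)); last by field; rewrite gt_eqF.
  rewrite ler_pM2l//.
  (* Here k >= 2 enters, as (k + 2) / k <= 2. *)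
  have : (k + 2) / k * eps / 24 <= eps / 12.
    rewrite (_ : _ / 24 = (k + 2) * (eps / 24) / k); last by field; rewrite gt_eqF.
    by rewrite ler_pdivrMr//; nra.
  have : eta * ((k + 2) * (2 * M ^+ 2 + La ^+ 2)) <= 2 * (eta * ((k + 2) * (M ^+ 2 + La ^+ 2))).
    rewrite [leRHS]mulrCA ler_pM2l// [leRHS]mulrCA ler_pM2l; last by lra.
    by have := sqr_ge0 La; lra.
  lra.
have ek : 0 <= eps * (k * (k + 1)) by rewrite mulr_ge0 ?(ltW e0)// ltW.
move: T3; rewrite mulrDr; lra.
Qed.

Lemma le_of_sqr (x y : R) : 0 <= y -> x ^+ 2 <= y ^+ 2 -> x <= y.
Proof.
move=> y0; apply: contraTT; rewrite -!ltNge => yx.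
by rewrite ltrXn2r// ltW.
Qed.

Lemma sqr_add_le M La : 0 <= M -> 0 <= La -> M ^+ 2 + La ^+ 2 <= (M + La) ^+ 2.
Proof. by move=> *; nra. Qed.

Lemma variance_budget c D M La e : 0 <= c -> 0 <= M -> 0 <= La ->
  c * D ^+ 2 * (M + La) ^+ 2 <= e -> c * D ^+ 2 * (M ^+ 2 + La ^+ 2) <= e.
Proof.
move=> c0 M0 La0; apply: le_trans.
by apply: ler_wpM2l; [rewrite mulr_ge0// sqr_ge0|exact: sqr_add_le].
Qed.

(** The constant is 24^2 / 3 = 192; for the probability bound it is 2 * 16^2 = 512. *)
Lemma variance_budget_expectation D M La eps k : 0 <= M -> 0 <= La -> 0 < eps ->
  (24 * D) ^+ 2 * (M + La) ^+ 2 / (3 * eps ^+ 2) <= k ->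
  192 * D ^+ 2 * (M ^+ 2 + La ^+ 2) <= k * eps ^+ 2.
Proof.
move=> M0 La0 e0; rewrite ler_pdivrMr ?mulr_gt0 ?exprn_gt0// => H.
by apply: (variance_budget (ler0n _ 192) M0 La0); lra.
Qed.

Lemma variance_budget_probability D M La eps k : 0 <= M -> 0 <= La -> 0 < eps ->
  2 * (16 * D) ^+ 2 * (M + La) ^+ 2 / eps ^+ 2 <= k ->
  512 * D ^+ 2 * (M ^+ 2 + La ^+ 2) <= k * eps ^+ 2.
Proof.
move=> M0 La0 e0; rewrite ler_pdivrMr ?exprn_gt0// => H.
apply: (variance_budget (ler0n _ 512) M0 La0); apply: le_trans H.
by rewrite le_eqVlt; apply/orP; left; apply/eqP; ring.
Qed.

(** After squaring, both estimates involve b only through b^2 S (2k+3)(k+2)k = 6 D^2 and become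
    polynomial inequalities in k. The first says that 1/b is small enough for the distance term, the
    second that b is small enough for the variance term. *)
Lemma stepsize_expectation D S eps k (b := Num.sqrt (6 / (S * (2 * k + 3) * (k + 2) * k)) * D) :
  0 < D -> 0 < S -> 0 < eps -> 2 <= k -> 192 * D ^+ 2 * S <= k * eps ^+ 2 ->
  [/\ 0 < b, 16 * D ^+ 2 <= eps * (k + 1) ^+ 2 * b & 16 * b * (k + 2) * S <= 3 * eps].
Proof.
move=> D0 S0 e0 k2 H.
have k0 : 0 < k by lra.
have q0 : 0 < S * (2 * k + 3) * (k + 2) * k by rewrite !mulr_gt0//; lra.
have b0 : 0 < b by rewrite mulr_gt0// sqrtr_gt0 divr_gt0.
have b2 : b ^+ 2 * (S * (2 * k + 3) * (k + 2) * k) = 6 * D ^+ 2.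
  by rewrite exprMn sqr_sqrtr ?divr_ge0 ?(ltW q0)//; field; rewrite !gt_eqF//; lra.
split=> //.
- apply: le_of_sqr; first by rewrite pmulr_lge0// pmulr_rge0// sqr_ge0.
  rewrite -(ler_pM2r q0) [leRHS](_ : _ = eps ^+ 2 * (k + 1) ^+ 4 *
     (b ^+ 2 * (S * (2 * k + 3) * (k + 2) * k))); last by ring.
  rewrite b2.
  have D2 : 0 < D ^+ 2 by rewrite exprn_gt0.
  rewrite [leLHS](_ : _ = (4 / 3 * (192 * D ^+ 2 * S) * (k * (k + 2) * (2 * k + 3))) * D ^+ 2);
    last by field.
  rewrite mulrA ler_pM2r//.
  apply: (@le_trans _ _ (4 / 3 * (k * eps ^+ 2) * (k * (k + 2) * (2 * k + 3)))).
    by rewrite ler_wpM2r ?ler_wpM2l// !mulr_ge0//; lra.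
  rewrite [leLHS](_ : _ = eps ^+ 2 * (4 / 3 * (k * k * (k + 2) * (2 * k + 3)))); last by ring.
  rewrite [leRHS](_ : _ = eps ^+ 2 * (6 * (k + 1) ^+ 4)); last by ring.
  rewrite ler_wpM2l ?sqr_ge0//.
  have : 0 <= k ^+ 2 by rewrite sqr_ge0.
  have : 0 <= k ^+ 3 by rewrite exprn_ge0// ltW.
  have : 0 <= k ^+ 4 by rewrite exprn_ge0// ltW.
  have -> : (k + 1) ^+ 4 = k ^+ 4 + 4 * k ^+ 3 + 6 * k ^+ 2 + 4 * k + 1 by ring.
  have -> : k * k * (k + 2) * (2 * k + 3) = 2 * k ^+ 4 + 7 * k ^+ 3 + 6 * k ^+ 2 by ring.
  lra.
- apply: le_of_sqr; first by rewrite pmulr_rge0// ltW.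
  have q1 : 0 < (2 * k + 3) * k by rewrite mulr_gt0//; lra.
  rewrite -(ler_pM2r q1) [leLHS](_ : _ = 256 * (k + 2) * S *
     (b ^+ 2 * (S * (2 * k + 3) * (k + 2) * k))); last by ring.
  rewrite b2 [leLHS](_ : _ = 8 * (k + 2) * (192 * D ^+ 2 * S)); last by ring.
  apply: (@le_trans _ _ (8 * (k + 2) * (k * eps ^+ 2))).
    by rewrite ler_wpM2l//; lra.
  rewrite [leLHS](_ : _ = k * eps ^+ 2 * (8 * (k + 2))); last by ring.
  rewrite [leRHS](_ : _ = k * eps ^+ 2 * (9 * (2 * k + 3))); last by ring.
  rewrite ler_wpM2l ?mulr_ge0 ?sqr_ge0 ?(ltW k0)//; lra.
Qed.

Lemma stepsize_probability D S eps k (b := Num.sqrt (2 / (S * (k + 2) ^+ 2 * k)) * D) :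
  0 < D -> 0 < S -> 0 < eps -> 2 <= k -> 512 * D ^+ 2 * S <= k * eps ^+ 2 ->
  [/\ 0 < b, 16 * D ^+ 2 <= eps * (k + 1) ^+ 2 * b & 16 * b * (k + 2) * S <= 3 * eps].
Proof.
move=> D0 S0 e0 k2 H.
have k0 : 0 < k by lra.
have k20 : 0 < k + 2 by lra.
have q0 : 0 < S * (k + 2) ^+ 2 * k by rewrite !mulr_gt0// exprn_gt0.
have b0 : 0 < b by rewrite mulr_gt0// sqrtr_gt0 divr_gt0.
have b2 : b ^+ 2 * (S * (k + 2) ^+ 2 * k) = 2 * D ^+ 2.
  by rewrite exprMn sqr_sqrtr ?divr_ge0 ?(ltW q0)//; field; rewrite !gt_eqF.
split=> //.
- apply: le_of_sqr; first by rewrite pmulr_lge0// pmulr_rge0// sqr_ge0.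
  rewrite -(ler_pM2r q0) [leRHS](_ : _ = eps ^+ 2 * (k + 1) ^+ 4 *
     (b ^+ 2 * (S * (k + 2) ^+ 2 * k))); last by ring.
  rewrite b2.
  have D2 : 0 < D ^+ 2 by rewrite exprn_gt0.
  rewrite [leLHS](_ : _ = (1 / 2 * (512 * D ^+ 2 * S) * (k * (k + 2) ^+ 2)) * D ^+ 2);
    last by field.
  rewrite mulrA ler_pM2r//.
  apply: (@le_trans _ _ (1 / 2 * (k * eps ^+ 2) * (k * (k + 2) ^+ 2))).
    by rewrite ler_wpM2r ?ler_wpM2l// mulr_ge0 ?sqr_ge0// ltW.
  rewrite [leLHS](_ : _ = eps ^+ 2 * (1 / 2 * (k * (k + 2)) ^+ 2)); last by ring.
  rewrite [leRHS](_ : _ = eps ^+ 2 * (2 * (k + 1) ^+ 4)); last by ring.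
  rewrite ler_wpM2l ?sqr_ge0//.
  have : 0 <= k ^+ 2 by rewrite sqr_ge0.
  have : 0 <= k ^+ 3 by rewrite exprn_ge0// ltW.
  have : 0 <= k ^+ 4 by rewrite exprn_ge0// ltW.
  have -> : (k + 1) ^+ 4 = k ^+ 4 + 4 * k ^+ 3 + 6 * k ^+ 2 + 4 * k + 1 by ring.
  have -> : (k * (k + 2)) ^+ 2 = k ^+ 4 + 4 * k ^+ 3 + 4 * k ^+ 2 by ring.
  lra.
- apply: le_of_sqr; first by rewrite pmulr_rge0// ltW.
  rewrite -(ler_pM2r k0) [leLHS](_ : _ = 256 * S *
     (b ^+ 2 * (S * (k + 2) ^+ 2 * k))); last by ring.
  rewrite b2 [leLHS](_ : _ = 512 * D ^+ 2 * S); last by ring.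
  apply: le_trans H _.
  rewrite [leRHS](_ : _ = 9 * (k * eps ^+ 2)); last by ring.
  by rewrite ler_peMl ?mulr_ge0 ?sqr_ge0 ?(ltW k0)//; lra.
Qed.

End StepSizeBudget.

(** * Deterministic potential along a path *)

(** With c the iteration index, multiplication by (c+1)(c+2) turns (1 - gamma) gap into c(c+1) gap.
    The distance coefficient becomes V1, which exceeds the previous V0, so the sum does not
    telescope exactly; the defect (V1 - V0) d is at most (V1 - V0) D^2. *)
Lemma potential_step {R : realType} (c eta D d d' gap gap' c0 w Q Z S1 S2 S3 : R) :
  0 <= c -> 0 < eta -> d <= D ^+ 2 ->
  gap' <= (1 - 2 / (c + 2)) * gap + (2 / (c + 2)) ^+ 2 / (2 * eta) * (d - d')
    + (c0 + w * Q + 2 / (c + 2) * Z) ->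
  c * (c + 1) * gap + 2 / eta * (c / (c + 1)) * d
    <= 2 / eta * (c / (c + 1)) * D ^+ 2 + S1 + S2 + 2 * S3 ->
  (c + 1) * (c + 1 + 1) * gap' + 2 / eta * ((c + 1) / (c + 1 + 1)) * d'
    <= 2 / eta * ((c + 1) / (c + 1 + 1)) * D ^+ 2 + (S1 + (c + 1) * (c + 2) * c0)
       + (S2 + (c + 1) * (c + 2) * w * Q) + 2 * (S3 + (c + 1) * Z).
Proof.
move=> c0' eta_gt0 dD step IH.
have c1 : 0 < c + 1 by lra.
have c2 : 0 < c + 2 by lra.
have c12 : 0 < (c + 1) * (c + 2) by rewrite mulr_gt0.
have -> : c + 1 + 1 = c + 2 by ring.
move: IH; set V0 := 2 / eta * (c / (c + 1)).
set V1 := 2 / eta * ((c + 1) / (c + 2)) => IH.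
have V01 : V0 <= V1.
  rewrite /V0 /V1 ler_wpM2l ?divr_ge0 ?(ltW eta_gt0)//.
  by rewrite ler_pdivrMr// mulrAC ler_pdivlMr//; nra.
have := ler_wpM2l (ltW c12) step.
have -> : (c + 1) * (c + 2) * ((1 - 2 / (c + 2)) * gap
    + (2 / (c + 2)) ^+ 2 / (2 * eta) * (d - d')
    + (c0 + w * Q + 2 / (c + 2) * Z)) = c * (c + 1) * gap + V1 * (d - d')
    + ((c + 1) * (c + 2) * c0 + (c + 1) * (c + 2) * w * Q + 2 * ((c + 1) * Z)).
  by rewrite /V1; field; rewrite !gt_eqF.
have : 0 <= (V1 - V0) * (D ^+ 2 - d) by rewrite mulr_ge0// subr_ge0.
lra.
Qed.

Section Iterates.
Context {R : realType} {n : nat}.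
Variables (f h : 'rV[R]_n -> \bar R).
Hypotheses (f_proper : proper_function f) (h_proper : proper_function h).
Hypotheses (h_lsc : lower_semicontinuous h).
Hypotheses (h_convex : econvex_function h).
Hypothesis dom_sub : effective_domain h `<=` effective_domain f.
Hypothesis h_bounded : bounded_set (effective_domain h).
Variables (Lf Hf Mf nu : R).
Hypotheses (Hf_ge0 : 0 <= Hf).
Hypothesis nu01 : 0 < nu < 1.
Hypothesis f_subgrad : forall x y gx gy : 'rV[R]_n,
  effective_domain f x -> effective_domain f y ->
  subdifferential f x gx -> subdifferential f y gy ->
  enorm (gy - gx) <= Lf * enorm (y - x) + Hf * enorm (y - x) `^ nu + Mf.
Variable grad : 'rV[R]_n -> 'rV[R]_n.
Hypothesis grad_sub : forall x, effective_domain f x -> subdifferential f x (grad x).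
Variables (alpha sigma D eps : R).
Hypotheses (alpha12 : 1 < alpha <= 2) (sigma_gt0 : 0 < sigma).
Hypotheses (D_gt0 : 0 < D) (eps_gt0 : 0 < eps).
Hypothesis diam : forall x y, effective_domain h x -> effective_domain h y ->
  enorm (x - y) <= D.
Context {dX : measure_display} {Xi : measurableType dX}.
Variables (G : 'rV[R]_n -> Xi -> 'rV[R]_n).
Variables (x0 u : 'rV[R]_n).
Hypotheses (x0_dom : effective_domain h x0) (u_dom : effective_domain h u).
Variables (eta eps' : R).
Hypotheses (eta_gt0 : 0 < eta) (eps'_gt0 : 0 < eps').
Hypothesis etaL : 4 * eta * (Lf + Lsmooth Hf nu eps') <= 1.

Definition gam (k : nat) : R := 2 / (k%:R + 2).

Lemma gam01 k : 0 < gam k <= 1.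
Proof.
have k0 : 0 <= k%:R :> R by [].
by rewrite /gam divr_gt0 ?ltr_wpDl// ler_pdivrMr ?ltr_wpDl// mul1r lerDr.
Qed.

Section Path.
Variable s : nat -> Xi.

Local Notation st k := (prox_subgradient h G gam (fun i => (i%:R + 2) * eta / 2) x0 s k).
Let y k : 'rV[R]_n := (1 - gam k) *: (st k).2 + gam k *: (st k).1.
Let noise k : 'rV[R]_n := G (y k) (s k) - grad (y k).
Let gap k := fine (f (st k).2) + fine (h (st k).2) - (fine (f u) + fine (h u)).

Lemma prox_subgradientS k :
  st k.+1 = let x' := prox h (eta / gam k) ((st k).1 - (eta / gam k) *: G (y k) (s k)) in
            (x', (1 - gam k) *: (st k).2 + gam k *: x').
Proof.
rewrite /y /=; case: (prox_subgradient _ _ _ _ _ _ _) => x z /=.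
have -> : (k%:R + 2) * eta / 2 = eta / gam k.
  by rewrite /gam; field; rewrite gt_eqF// ltr_wpDl.
by [].
Qed.

Lemma prox_subgradient_dom k :
  effective_domain h (st k).1 /\ effective_domain h (st k).2.
Proof.
elim: k => [//|k [IHx IHz]]; rewrite prox_subgradientS /=.
have px := prox_dom (eta / gam k) h_proper h_lsc h_bounded
  ((st k).1 - (eta / gam k) *: G (y k) (s k)).
split=> //; rewrite addrC.
by have [] := econvex_dom h_convex h_proper (gam01 k) px IHz.
Qed.

Lemma prox_subgradient_dom_mid k : effective_domain f (y k).
Proof.
have [hx hz] := prox_subgradient_dom k; apply: dom_sub; rewrite /y addrC.
by have [] := econvex_dom h_convex h_proper (gam01 k) hx hz.
Qed.

Let v (k : nat) : R := 2 / eta * (k%:R / (k%:R + 1)).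

(** At k = 0 both coefficients on the left vanish, so no information on the initial gap enters. *)
Lemma prox_subgradient_potential k :
  k%:R * (k%:R + 1) * gap k + v k * enorm (u - (st k).1) ^+ 2 <=
    v k * D ^+ 2
    + \sum_(j < k) (j%:R + 1) * (j%:R + 2) * (eps' / 8 + 2 * eta * Mf ^+ 2)
    + \sum_(j < k) (j%:R + 1) * (j%:R + 2) * noise_weight alpha sigma D eps eta (gam j)
        * (enorm (noise j) `^ alpha / sigma `^ alpha)
    + 2 * \sum_(j < k) (j%:R + 1) * dot (noise j) (u - (st j).1).
Proof.
elim: k => [|k IH].
  by rewrite !big_ord0 /v !(mul0r, mulr0, addr0).
have [hx hz] := prox_subgradient_dom k.
have := prox_subgradient_step f_proper h_proper h_lsc h_convex dom_sub
  h_bounded Hf_ge0 nu01 f_subgrad grad_sub alpha12 sigma_gt0 D_gt0 eps_gt0 diam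
  (G (y k) (s k)) eta_gt0 (gam01 k) eps'_gt0 etaL hx hz u_dom.
have dD : enorm (u - (st k).1) ^+ 2 <= D ^+ 2.
  by rewrite lerXn2r ?nnegrE ?enorm_ge0 ?(ltW D_gt0)// diam.
move=> step; rewrite !big_ord_recr /gap /v prox_subgradientS -natr1.
exact: (potential_step (ler0n _ _) eta_gt0 dD step IH).
Qed.

End Path.
End Iterates.

(** * Exponential tails *)

Section ExponentialTail.
Context {R : realType} {d : measure_display} {T : measurableType d}.
Variable P : probability T R.

(** Markov's inequality for exp Y at the level exp(c + l). *)
Lemma expR_tail_bound (Y : T -> R) (c l : R) : measurable_fun [set: T] Y ->
  (\int[P]_t (expR (Y t))%:E <= (expR c)%:E)%E ->
  (P [set t | (c + l <= Y t)%R] <= (expR (- l))%:E)%E.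
Proof.
move=> mY EY.
have mE : measurable_fun [set: T] (fun t => (expR (Y t))%:E).
  by apply/measurable_EFinP; exact: measurableT_comp.
have := le_integral_abse P measurableT mE (expR_gt0 (c + l)).
rewrite setTI (_ : [set t | _] = [set t | c + l <= Y t]); last first.
  by apply/seteqP; split=> t /=; rewrite lee_fin ger0_norm ?expR_ge0// ler_expR.
under eq_integral do rewrite gee0_abs ?lee_fin ?expR_ge0//.
move=> /le_trans/(_ EY); rewrite -lee_pdivlMl ?expR_gt0//.
by rewrite -EFinM -expRN -expRD opprD addrAC addNr add0r.
Qed.

(* Tangent line of exp at the weighted mean. *)
Lemma expR_Jensen (I : finType) (p q : I -> R) :
  (forall i, 0 <= p i) -> \sum_i p i = 1 ->
  expR (\sum_i p i * q i) <= \sum_i p i * expR (q i).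
Proof.
move=> p0 p1; set m := \sum_i p i * q i.
have H i : p i * (expR m * (1 + (q i - m))) <= p i * expR (q i).
  rewrite ler_wpM2l// -[leRHS](_ : expR m * expR (q i - m) = _); last first.
    by rewrite -expRD subrKC.
  by rewrite ler_wpM2l ?expR_ge0// expR_ge1Dx.
apply: le_trans (ler_sum _ (fun i _ => H i)).
have -> : \sum_i p i * (expR m * (1 + (q i - m))) =
    expR m * (\sum_i p i * (1 - m)) + expR m * (\sum_i p i * q i).
  rewrite -mulrDr -big_split mulr_sumr; apply: eq_bigr => i _ /=; ring.
by rewrite -mulr_suml p1 mul1r -/m -mulrDr subrK mulr1.
Qed.

Lemma integral_expR_Jensen (I : finType) (p : I -> R) (q : I -> T -> R) (c : R) :
  (forall i, 0 <= p i) -> \sum_i p i = 1 ->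
  (forall i, measurable_fun [set: T] (q i)) ->
  (forall i, \int[P]_t (expR (q i t))%:E <= (expR c)%:E)%E ->
  (\int[P]_t (expR (\sum_i p i * q i t))%:E <= (expR c)%:E)%E.
Proof.
move=> p0 p1 mq Eq.
have mE i : measurable_fun [set: T] (fun t => (expR (q i t))%:E).
  by apply/measurable_EFinP; exact: measurableT_comp.
have mpE i : measurable_fun [set: T] (fun t => (p i)%:E * (expR (q i t))%:E)%E.
  exact: measurable_funeM.
apply: (@le_trans _ _ (\int[P]_t (\sum_i (p i)%:E * (expR (q i t))%:E))%E).
  apply: ge0_le_integral => //.
  - apply/measurable_EFinP; apply: measurableT_comp => //.
    by apply: measurable_sum => i; exact: measurable_funM.
  - exact: emeasurable_sum.
  - move=> t _; apply: (@le_trans _ _ (\sum_i p i * expR (q i t))%:E).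
      by rewrite lee_fin expR_Jensen.
    by rewrite -sumEFin; apply: lee_sum => i _; rewrite EFinM.
rewrite ge0_integral_sum//; last first.
  by move=> i t _; rewrite -EFinM lee_fin mulr_ge0 ?expR_ge0.
have -> : (expR c)%:E = (\sum_i (p i)%:E * (expR c)%:E)%E.
  transitivity (\sum_i p i * expR c)%:E; first by rewrite -mulr_suml p1 mul1r.
  by rewrite -sumEFin; apply: eq_bigr => i _; rewrite EFinM.
apply: lee_sum => i _; rewrite ge0_integralZl_EFin//.
by rewrite lee_wpmul2l// lee_fin.
Qed.

End ExponentialTail.

(** * Iterates as random variables *)

Section RandomIterates.
Context {R : realType} {n : nat}.
Variables (f h : 'rV[R]_n -> \bar R).
Hypotheses (h_proper : proper_function h) (h_lsc : lower_semicontinuous h).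
Hypothesis h_convex : econvex_function h.
Hypothesis dom_sub : effective_domain h `<=` effective_domain f.
Hypothesis h_bounded : bounded_set (effective_domain h).
Variable D : R.
Hypothesis D_gt0 : 0 < D.
Hypothesis diam : forall x y, effective_domain h x -> effective_domain h y ->
  enorm (x - y) <= D.
Context {dX : measure_display} {Xi : measurableType dX}.
Variables (mu : probability Xi R) (G : 'rV[R]_n -> Xi -> 'rV[R]_n).
Hypothesis G_meas : measurable_fun [set: borel_rV R n * Xi]
     (fun p : borel_rV R n * Xi => G p.1 p.2 : borel_rV R n).
Variables (sigma alpha : R).
Hypotheses (sigma_gt0 : 0 < sigma) (alpha12 : 1 < alpha <= 2).
Hypothesis G_integrable : forall (x : 'rV[R]_n) (j : 'I_n), effective_domain f x ->
  mu.-integrable [set: Xi] (fun s => (G x s 0 j)%:E).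
Context {dO : measure_display} {Omega : measurableType dO}.
Variables (P : probability Omega R) (xi : nat -> Omega -> Xi).
Hypothesis xi_iid : iid_samples P mu xi.
Variables (x0 u : 'rV[R]_n).
Hypotheses (x0_dom : effective_domain h x0) (u_dom : effective_domain h u).
Variable eta : R.
Hypothesis eta_gt0 : 0 < eta.

Local Notation state := (borel_rV R n * borel_rV R n * R)%type.

Definition mid_point (k : nat) (p : state) : 'rV[R]_n :=
  (1 - gam k) *: (p.1.2 : 'rV[R]_n) + gam k *: (p.1.1 : 'rV[R]_n).

Definition oracle_noise (y : 'rV[R]_n) (s : Xi) : 'rV[R]_n := G y s - mean_oracle mu G y.

(* The third component accumulates the weighted martingale differences, so
   that their partial sums are a function of the past as well. *)
Definition transition (k : nat) (p : state) (s : Xi) : state :=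
  let y := mid_point k p in
  let x' := prox h (eta / gam k) ((p.1.1 : 'rV[R]_n) - (eta / gam k) *: G y s) in
  ((x' : borel_rV R n, (1 - gam k) *: (p.1.2 : 'rV[R]_n) + gam k *: x' : borel_rV R n),
   p.2 + (k%:R + 1) * dot (oracle_noise y s) (u - (p.1.1 : 'rV[R]_n))).

Local Notation vec p := (p : 'rV[R]_n).

Lemma measurable_mid_point d (T : measurableType d) (g : T -> state) k :
  measurable_fun [set: T] g ->
  measurable_fun [set: T] ((fun t => mid_point k (g t)) : T -> borel_rV R n).
Proof.
move=> mg; have m1 := measurableT_comp measurable_fst mg.
apply: measurable_borel_rV; apply: measurable_vecD; apply: measurable_vecZ.
  exact: (measurable_vec_borel (measurableT_comp measurable_snd m1)).
exact: (measurable_vec_borel (measurableT_comp measurable_fst m1)).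
Qed.

Lemma measurable_transition k :
  measurable_fun [set: state * Xi] (fun p : state * Xi => transition k p.1 p.2).
Proof.
have mp := @measurable_fst _ _ state Xi; have ms := @measurable_snd _ _ state Xi.
have m1 := measurableT_comp measurable_fst mp.
have mx := measurable_vec_borel (measurableT_comp measurable_fst m1).
have mz := measurable_vec_borel (measurableT_comp measurable_snd m1).
have my := measurable_mid_point k mp.
have mG := measurableT_comp G_meas (measurable_fun_pair my ms).
have eg0 : 0 < eta / gam k by rewrite divr_gt0//; have /andP[] := @gam01 R k.
have mx' : measurable_fun [set: state * Xi] (fun p : state * Xi =>
    prox h (eta / gam k) (vec p.1.1.1 - (eta / gam k) *: G (mid_point k p.1) p.2)
    : borel_rV R n).
  have mprox := measurable_continuous_rV
    (prox_continuous h_proper h_lsc h_convex eg0 h_bounded).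
  apply: (measurableT_comp mprox); apply: measurable_borel_rV.
  apply: measurable_vecB => //; apply: measurable_vecZ.
  exact: measurable_vec_borel mG.
apply: measurable_fun_pair.
  apply: measurable_fun_pair => //; apply: measurable_borel_rV.
  apply: measurable_vecD; apply: measurable_vecZ => //.
  exact: measurable_vec_borel mx'.
apply: measurable_funD; first exact: (measurableT_comp measurable_snd mp).
apply: measurable_funM => //; apply: measurable_dot.
  exact: (measurable_oracle_noise mu G_meas my ms).
by apply: measurable_vecB.
Qed.

Local Notation W k := (fun w => chain ((x0 : borel_rV R n, x0 : borel_rV R n), 0 : R)
  transition (xi ^~ w) k).
Local Notation st k w :=
  (prox_subgradient h G gam (fun i => (i%:R + 2) * eta / 2) x0 (xi ^~ w) k).
Local Notation ymid k w := ((1 - gam k) *: (st k w).2 + gam k *: (st k w).1).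

Lemma chainE k w : W k w = (((st k w).1, (st k w).2),
  \sum_(j < k) (j%:R + 1) * dot (oracle_noise (ymid j w) (xi j w)) (u - (st j w).1)).
Proof.
elim: k => [|k IH]; first by rewrite big_ord0.
by rewrite [LHS]/= IH big_ord_recr prox_subgradientS.
Qed.

Let mxi k : measurable_fun [set: Omega] (xi k). Proof. by case: xi_iid. Qed.

Let mW k : measurable_fun [set: Omega] (W k).
Proof. exact: (measurable_chain xi_iid _ measurable_transition). Qed.

Lemma measurable_iterate k :
  measurable_fun [set: Omega] ((fun w => (st k w).1) : Omega -> borel_rV R n) /\
  measurable_fun [set: Omega] ((fun w => (st k w).2) : Omega -> borel_rV R n).
Proof.
have m1 := measurableT_comp measurable_fst (mW k).
have := (measurableT_comp measurable_fst m1, measurableT_comp measurable_snd m1).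
rewrite (_ : fst \o _ = (fun w => ((st k w).1 : borel_rV R n, (st k w).2 : borel_rV R n))).
  by case.
by apply/funext => w /=; rewrite chainE.
Qed.

Lemma measurable_ymid k :
  measurable_fun [set: Omega] ((fun w => ymid k w) : Omega -> borel_rV R n).
Proof.
have := measurable_mid_point k (mW k).
rewrite (_ : (fun w => _) = (fun w => ymid k w))//.
by apply/funext => w; rewrite chainE.
Qed.

Lemma measurable_noise k j :
  measurable_fun [set: Omega] (fun w => oracle_noise (ymid k w) (xi k w) 0 j).
Proof. exact: (measurable_oracle_noise mu G_meas (measurable_ymid k) (mxi k)). Qed.

Lemma iterate_dom k w :
  [/\ effective_domain h (st k w).1, effective_domain h (st k w).2
    & effective_domain f (ymid k w)].
Proof.
have [hx hz] := prox_subgradient_dom h_proper h_lsc h_convex h_bounded G x0_dom eta (xi ^~ w) k.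
by split=> //; exact: prox_subgradient_dom_mid.
Qed.

(** A bound on the average over a fresh sample, with the state frozen, passes to the expectation
    along the method. *)
Lemma ge0_le_integral_step k (phi : state * Xi -> \bar R) (psi : Omega -> \bar R) :
  measurable_fun [set: state * Xi] phi -> (forall p, 0 <= phi p)%E ->
  measurable_fun [set: Omega] psi ->
  (forall w, \int[mu]_s phi (W k w, s) <= psi w)%E ->
  (\int[P]_w phi (W k w, xi k w) <= \int[P]_w psi w)%E.
Proof.
move=> mphi phi0 mpsi le_psi.
rewrite (ge0_integral_chain xi_iid _ measurable_transition)//.
apply: ge0_le_integral => //.
- by move=> w _; exact: integral_ge0.
- have mF := @measurable_fun_fubini_tonelli_F _ _ _ _ _ mu _ mphi phi0.
  exact: (measurableT_comp mF (mW k)).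
Qed.

Lemma measurable_state_noise k j : measurable_fun [set: state * Xi]
  (fun p : state * Xi => oracle_noise (mid_point k p.1) p.2 0 j).
Proof.
exact: (measurable_oracle_noise mu G_meas
  (measurable_mid_point k measurable_fst) measurable_snd).
Qed.

(** The oracle bound is uniform over dom f, where every query point lies, so it survives at a random
    query point. *)
Lemma integral_error_le k (g : R -> R) (c : R) : measurable_fun [set: R] g ->
  (forall r, 0 <= g r) ->
  (forall x, effective_domain f x ->
     \int[mu]_s (g (oracle_error mu G x s))%:E <= c%:E)%E ->
  (\int[P]_w (g (enorm (oracle_noise (ymid k w) (xi k w))))%:E <= c%:E)%E.
Proof.
move=> mg g0 gc; rewrite -(integral_cst_probability P).
pose phi (p : state * Xi) := (g (enorm (oracle_noise (mid_point k p.1) p.2)))%:E.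
have -> : (fun w => (g (enorm (oracle_noise (ymid k w) (xi k w))))%:E) =
    (fun w => phi (W k w, xi k w)).
  by apply/funext => w; rewrite chainE.
apply: ge0_le_integral_step => //.
- apply/measurable_EFinP; apply: measurableT_comp => //.
  by apply: measurable_enorm; exact: measurable_state_noise.
- by move=> p; rewrite lee_fin.
- move=> w; rewrite chainE /phi /=; apply: gc.
  by have [] := iterate_dom k w.
Qed.

Let Z k w := dot (oracle_noise (ymid k w) (xi k w)) (u - (st k w).1).

Lemma enorm_u_iterate k w : enorm (u - (st k w).1) <= D.
Proof. by apply: diam => //; case: (iterate_dom k w). Qed.

Let measurable_Z k : measurable_fun [set: Omega] (Z k).
Proof.
apply: measurable_dot; first exact: measurable_noise.
by apply: measurable_vecB => //; exact: (measurable_vec_borel (measurable_iterate k).1).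
Qed.

Let zphi k (p : state * Xi) : R :=
  dot (oracle_noise (mid_point k p.1) p.2) (u - (p.1.1.1 : 'rV[R]_n)).

Let measurable_zphi k : measurable_fun [set: state * Xi] (zphi k).
Proof.
apply: measurable_dot; first exact: measurable_state_noise.
apply: measurable_vecB => //; apply: measurable_vec_borel.
exact: (measurableT_comp measurable_fst (measurableT_comp measurable_fst measurable_fst)).
Qed.

Let ZE k w : Z k w = zphi k (W k w, xi k w).
Proof. by rewrite /zphi /= chainE. Qed.

(** Integrability follows from |Z| <= D |e| <= D (1 + |e|^alpha), since alpha > 1. As Z changes
    sign, Tonelli is applied to its positive and negative parts separately. *)
Lemma martingale_difference k :
  (forall x, effective_domain f x ->
     \int[mu]_s (oracle_error mu G x s `^ alpha)%:E <= (sigma `^ alpha)%:E)%E ->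
  P.-integrable [set: Omega] (EFin \o Z k) /\ (\int[P]_w (Z k w)%:E = 0)%E.
Proof.
move=> moment; have [a1 a2] := andP alpha12.
have iZ : P.-integrable [set: Omega] (EFin \o Z k).
  apply/integrableP; split; first exact/measurable_EFinP.
  apply: (@le_lt_trans _ _ (\int[P]_w
      (D * (1 + enorm (oracle_noise (ymid k w) (xi k w)) `^ alpha))%:E)%E).
    apply: ge0_le_integral => //.
    - by apply: measurableT_comp => //; exact/measurable_EFinP.
    - apply/measurable_EFinP; apply: measurable_funM => //; apply: measurable_funD => //.
      apply: (measurableT_comp (measurable_powR _)); apply: measurable_enorm.
      exact: measurable_noise.
    - move=> w _; rewrite /= lee_fin; apply: le_trans (norm_dot_le _ _) _.
      rewrite mulrC; apply: ler_pM; rewrite ?enorm_ge0//; first exact: enorm_u_iterate.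
      set r := enorm _; have r0 : 0 <= r by exact: enorm_ge0.
      have [r1|r1] := leP r 1.
        by apply: le_trans r1 _; rewrite lerDl powR_ge0.
      apply: (@le_trans _ _ (r `^ alpha)); last by rewrite lerDr.
      by apply: le1r_powR; exact: ltW.
  apply: (@le_lt_trans _ _ (D * (1 + sigma `^ alpha))%:E); last exact: ltry.
  have := @integral_error_le k (fun r => D * (1 + r `^ alpha)) (D * (1 + sigma `^ alpha)).
  apply.
  - apply: measurable_funM => //; apply: measurable_funD => //; exact: measurable_powR.
  - by move=> r; rewrite mulr_ge0 ?(ltW D_gt0)// addr_ge0// powR_ge0.
  - move=> x fx; under eq_integral do rewrite EFinM EFinD.
    have merr := measurable_oracle_error mu G_meas
      (measurable_cst (x : borel_rV R n)) (@measurable_id _ Xi setT).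
    have mpow : measurable_fun [set: Xi] (fun s => (oracle_error mu G x s `^ alpha)%:E).
      by apply/measurable_EFinP; exact: (measurableT_comp (measurable_powR _) merr).
    rewrite ge0_integralZl_EFin ?(ltW D_gt0)//; last 2 first.
    - by move=> s _; rewrite adde_ge0// lee_fin powR_ge0.
    - exact: emeasurable_funD.
    rewrite EFinM lee_wpmul2l ?lee_fin ?(ltW D_gt0)//.
    rewrite ge0_integralD//; last by move=> s _; rewrite lee_fin powR_ge0.
    by rewrite integral_cst_probability EFinD leeD2l// moment.
split=> //.
have mz : measurable_fun [set: state * Xi] (EFin \o zphi k) by exact/measurable_EFinP.
have Epos : (\int[P]_w ((EFin \o Z k)^\+ w) =
    \int[P]_w \int[mu]_s ((EFin \o zphi k)^\+ (W k w, s)))%E.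
  rewrite -(ge0_integral_chain xi_iid _ measurable_transition)//; last exact: measurable_funepos.
  by apply: eq_integral => w _; rewrite !funeposE /= ZE.
have Eneg : (\int[P]_w ((EFin \o Z k)^\- w) =
    \int[P]_w \int[mu]_s ((EFin \o zphi k)^\- (W k w, s)))%E.
  rewrite -(ge0_integral_chain xi_iid _ measurable_transition)//; last exact: measurable_funeneg.
  by apply: eq_integral => w _; rewrite !funenegE /= ZE.
(* With the state frozen, zero mean says that the two parts have the same finite integral. *)
have Ezero w : (\int[mu]_s ((EFin \o zphi k)^\+ (W k w, s)) =
    \int[mu]_s ((EFin \o zphi k)^\- (W k w, s)))%E.
  have [_ _ fy] := iterate_dom k w.
  have Gi j := G_integrable j fy.
  have := mean_dot_noise Gi (u - (st k w).1).
  have := integrable_dot_noise Gi (u - (st k w).1).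
  set q := fun s => _ => iq.
  have qE : q = fun s => (zphi k (W k w, s))%:E by apply/funext => s; rewrite chainE.
  rewrite integralE.
  have := integrable_fin_num measurableT (integrable_funepos measurableT iq).
  have := integrable_fin_num measurableT (integrable_funeneg measurableT iq).
  have -> : q^\+%E = fun s => ((EFin \o zphi k)^\+ (W k w, s))%E.
    by apply/funext => s; rewrite !funeposE qE.
  have -> : q^\-%E = fun s => ((EFin \o zphi k)^\- (W k w, s))%E.
    by apply/funext => s; rewrite !funenegE qE.
  move=> /fineK <- /fineK <-; rewrite -EFinB => -[/eqP].
  by rewrite subr_eq0 => /eqP ->.
have fin := integrable_fin_num measurableT (integrable_funeneg measurableT iZ).
by rewrite integralE Epos (eq_integral _ _ (fun w _ => Ezero w)) -Eneg subee.
Qed.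

Lemma measurable_martingale k :
  measurable_fun [set: Omega] (fun w => \sum_(j < k) (j%:R + 1) * Z j w).
Proof. by apply: measurable_sum => j; exact: measurable_funM. Qed.

(** The weight of the k-th difference, divided by K, is at most 1, so the effective parameter never
    exceeds lam and each step contributes at most exp(lam^alpha). *)
Lemma martingale_mgf (lam : R) (K : nat) : (0 < K)%N -> 0 <= lam ->
  lam <= 1 \/ alpha = 2 ->
  (forall x, effective_domain f x ->
    \int[mu]_s (expR (oracle_error mu G x s `^ alpha / sigma `^ alpha))%:E
      <= (expR 1)%:E)%E ->
  forall k, (k <= K)%N ->
  (\int[P]_w (expR (lam / (K%:R * D * sigma) * \sum_(j < k) (j%:R + 1) * Z j w))%:E
     <= (expR (k%:R * lam `^ alpha))%:E)%E.
Proof.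
move=> K0 lam0 lam1 exp_moment; elim=> [_|k IH kK].
  under eq_integral do rewrite big_ord0 mulr0.
  by rewrite integral_cst_probability mul0r.
have K0' : 0 < K%:R :> R by rewrite ltr0n.
have DS0 : 0 < D * sigma by rewrite mulr_gt0.
have [a1 a2] := andP alpha12.
pose tau := lam / (K%:R * D * sigma).
pose phi (p : state * Xi) := (expR (tau * (p.1.2 + (k%:R + 1) * zphi k p)))%:E.
pose psi w := ((expR (lam `^ alpha))%:E *
  (expR (tau * \sum_(j < k) (j%:R + 1) * Z j w))%:E)%E.
have mpsi : measurable_fun [set: Omega] (fun w =>
    (expR (tau * \sum_(j < k) (j%:R + 1) * Z j w))%:E).
  apply/measurable_EFinP; apply: measurableT_comp => //; apply: measurable_funM => //.
  exact: measurable_martingale.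
apply: (@le_trans _ _ (\int[P]_w psi w)%E); last first.
  rewrite ge0_integralZl_EFin ?expR_ge0//.
  apply: le_trans (lee_wpmul2l _ (IH (ltnW kK))) _; first by rewrite lee_fin expR_ge0.
  by rewrite -EFinM -expRD lee_fin ler_expR -natr1 mulrDl mul1r addrC.
have -> : (fun w => (expR (lam / (K%:R * D * sigma) *
    \sum_(j < k.+1) (j%:R + 1) * Z j w))%:E) = (fun w => phi (W k w, xi k w)).
  by apply/funext => w; rewrite big_ord_recr /= /phi -ZE /= chainE.
apply: ge0_le_integral_step.
- apply/measurable_EFinP; apply: measurableT_comp => //; apply: measurable_funM => //.
  apply: measurable_funD; last exact: measurable_funM.
  exact: (measurableT_comp measurable_snd measurable_fst).
- by move=> p; rewrite lee_fin expR_ge0.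
- exact: measurable_funeM.
move=> w; have [_ _ fy] := iterate_dom k w.
pose lam' := lam * ((k%:R + 1) / K%:R).
have lam'0 : 0 <= lam' by rewrite mulr_ge0// divr_ge0// ltW.
have lam'lam : lam' <= lam.
  rewrite -[leRHS]mulr1 ler_wpM2l// ler_pdivrMr// mul1r natr1 ler_nat.
  exact: kK.
have lam'1 : lam' <= 1 \/ alpha = 2.
  by case: lam1 => [l|]; [left; exact: le_trans l|right].
have Gi j := G_integrable j fy.
have := mgf_noise G_meas Gi sigma_gt0 alpha12 (exp_moment _ fy) D_gt0
  (enorm_u_iterate k w) lam'0 lam'1.
set q := fun s : Xi => (expR (_ / _ * _))%:E => Eq.
have -> : (fun s => phi (W k w, s)) =
    (fun s => ((expR (tau * \sum_(j < k) (j%:R + 1) * Z j w))%:E * q s)%E).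
  apply/funext => s; rewrite /phi /q /= chainE /= -EFinM -expRD.
  rewrite mulrDr; congr (expR (_ + _))%:E.
  rewrite /zphi /= /tau /lam' mulrA; congr (_ * _).
  by field; rewrite !gt_eqF.
rewrite ge0_integralZl_EFin ?expR_ge0//.
- rewrite /psi [leRHS]muleC; apply: lee_wpmul2l; first by rewrite lee_fin expR_ge0.
  apply: le_trans Eq _; rewrite lee_fin ler_expR.
  by apply: ge0_ler_powR; rewrite ?nnegrE//; lra.
- by move=> s _; rewrite lee_fin expR_ge0.
- apply/measurable_EFinP; apply: measurableT_comp => //; apply: measurable_funM => //.
  apply: measurable_dot => //.
  exact: (measurable_oracle_noise mu G_meas (measurable_cst (_ : borel_rV R n))
    (@measurable_id _ Xi setT)).
Qed.

End RandomIterates.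

(** * Convergence *)

Section Convergence.
Context {R : realType} {n : nat}.
Variables (f h : 'rV[R]_n -> \bar R).
Hypotheses (f_proper : proper_function f) (h_proper : proper_function h).
Hypotheses (f_lsc : lower_semicontinuous f) (h_lsc : lower_semicontinuous h).
Hypothesis h_convex : econvex_function h.
Hypothesis dom_sub : effective_domain h `<=` effective_domain f.
Variables (Lf Hf Mf nu : R).
Hypotheses (Hf_ge0 : 0 <= Hf) (nu01 : 0 < nu < 1).
Hypothesis f_subgrad : forall x y gx gy : 'rV[R]_n,
  effective_domain f x -> effective_domain f y ->
  subdifferential f x gx -> subdifferential f y gy ->
  enorm (gy - gx) <= Lf * enorm (y - x) + Hf * enorm (y - x) `^ nu + Mf.
Hypothesis h_bounded : bounded_set (effective_domain h).
Context {dX : measure_display} {Xi : measurableType dX}.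
Variables (mu : probability Xi R) (G : 'rV[R]_n -> Xi -> 'rV[R]_n).
Hypothesis G_meas : measurable_fun [set: borel_rV R n * Xi]
     (fun p : borel_rV R n * Xi => G p.1 p.2 : borel_rV R n).
Variables (sigma alpha : R).
Hypotheses (sigma_gt0 : 0 < sigma) (alpha12 : 1 < alpha <= 2).
Hypothesis G_integrable : forall (x : 'rV[R]_n) (j : 'I_n), effective_domain f x ->
  mu.-integrable [set: Xi] (fun s => (G x s 0 j)%:E).
Hypothesis G_unbiased : forall x, effective_domain f x ->
  subdifferential f x (mean_oracle mu G x).
Hypothesis G_moment : forall x, effective_domain f x ->
  (\int[mu]_s (oracle_error mu G x s `^ alpha)%:E <= (sigma `^ alpha)%:E)%E.
Variable D : R.
Hypothesis D_gt0 : 0 < D.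
Hypothesis diam : forall x y, effective_domain h x -> effective_domain h y ->
  enorm (x - y) <= D.
Context {dO : measure_display} {Omega : measurableType dO}.
Variables (P : probability Omega R) (xi : nat -> Omega -> Xi).
Hypothesis xi_iid : iid_samples P mu xi.
Variable x0 : 'rV[R]_n.
Hypothesis x0_dom : effective_domain h x0.

Lemma objective_argmin : exists u, effective_domain h u /\
  forall z, (objective f h u <= objective f h z)%E.
Proof.
have [[f_gt _] [h_gt _]] := (f_proper, h_proper).
have domE : effective_domain (objective f h) = effective_domain h.
  apply/seteqP; split=> x; rewrite /effective_domain /objective /=.
    by case: (f x) (f_gt x) => [r| |]//; case: (h x) (h_gt x).
  by move=> hx; rewrite lte_add_pinfty//; exact: dom_sub.
have [||u umin] := @lsc_argmin R n (objective f h) (lscD f_gt h_gt f_lsc h_lsc).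
- by rewrite domE.
- by rewrite domE; exists x0.
exists u; split=> //; rewrite -domE /effective_domain /=.
by apply: le_lt_trans (umin x0) _; have : effective_domain (objective f h) x0 by rewrite domE.
Qed.

Lemma gapE u z : effective_domain h u -> effective_domain h z ->
  (forall z, (objective f h u <= objective f h z)%E) ->
  (objective f h z - optimal_value f h)%E =
  (fine (f z) + fine (h z) - (fine (f u) + fine (h u)))%:E.
Proof.
move=> hu hz umin; have -> : optimal_value f h = objective f h u.
  apply/eqP; rewrite eq_le; apply/andP; split.
    by apply: ereal_inf_lbound; exists u.
  by apply: le_ereal_inf_tmp => _ [y _ <-]; exact: umin.
rewrite /objective EFinB !EFinD.
by rewrite !fineK//; apply: dom_fin_num => //; exact: dom_sub.
Qed.

Variables (eps eta : R) (K : nat).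
Hypotheses (eps_gt0 : 0 < eps) (eta_gt0 : 0 < eta) (K_gt0 : (0 < K)%N).
Local Notation k_ := (K%:R : R).
Hypothesis etaL : 4 * eta * (Lf + Lsmooth Hf nu (eps / k_)) <= 1.

Local Notation st k w :=
  (prox_subgradient h G gam (fun i => (i%:R + 2) * eta / 2) x0 (xi ^~ w) k).
Local Notation ymid k w := ((1 - gam k) *: (st k w).2 + gam k *: (st k w).1).
Local Notation noise k w := (oracle_noise mu G (ymid k w) (xi k w)).
Let Q k w := enorm (noise k w) `^ alpha / sigma `^ alpha.
Let Z u k w := dot (noise k w) (u - (st k w).1).
Let a (j : nat) : R := (j%:R + 1) * (j%:R + 2) * noise_weight alpha sigma D eps eta (gam j).
Let base : R := 2 / eta * (k_ / (k_ + 1)) * D ^+ 2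
  + k_ * (k_ + 1) * (k_ + 2) / 3 * (eps / k_ / 8 + 2 * eta * Mf ^+ 2).
Let gap u z : R := fine (f z) + fine (h z) - (fine (f u) + fine (h u)).

Lemma sum_rising_two (m : nat) :
  \sum_(j < m) (j%:R + 1) * (j%:R + 2) = m%:R * (m%:R + 1) * (m%:R + 2) / 3 :> R.
Proof.
elim: m => [|m IH]; first by rewrite big_ord0 !mul0r.
by rewrite big_ord_recr /= IH -natr1; field.
Qed.

Lemma sum_rising_one (m : nat) :
  \sum_(j < m) (2 * (j%:R + 1)) = m%:R * (m%:R + 1) :> R.
Proof.
elim: m => [|m IH]; first by rewrite big_ord0 !mul0r.
by rewrite big_ord_recr /= IH -natr1; ring.
Qed.

Lemma gap_path_bound u w : effective_domain h u ->
  k_ * (k_ + 1) * gap u (st K w).2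
    <= base + \sum_(j < K) a j * Q j w + 2 * \sum_(j < K) (j%:R + 1) * Z u j w.
Proof.
move=> hu; have k0 : 0 < k_ by rewrite ltr0n.
have ek0 : 0 < eps / k_ by rewrite divr_gt0.
have := prox_subgradient_potential f_proper h_proper h_lsc h_convex dom_sub
  h_bounded Hf_ge0 nu01 f_subgrad G_unbiased alpha12 sigma_gt0 D_gt0 eps_gt0 diam
  G x0_dom hu eta_gt0 ek0 etaL (xi ^~ w) K.
rewrite -mulr_suml sum_rising_two -/base => H.
apply: le_trans H; rewrite lerDl mulr_ge0 ?sqr_ge0//.
by rewrite mulr_ge0 ?divr_ge0// ?addr_ge0// ltW.
Qed.

(** The weight (j+1)(j+2) times [gam j] is 2(j+1), so the shares of eps add up to exactly eps/8
    after division by K(K+1). *)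
Lemma sum_noise_weight_le (C La : R) : 0 < C ->
  C `^ (alpha - 1)^-1 * Lambda alpha sigma D eps ^+ 2 = La ^+ 2 ->
  C * \sum_(j < K) a j <=
    k_ * (k_ + 1) * (k_ + 2) / 3 * (eta * La ^+ 2) + eps / 8 * (k_ * (k_ + 1)).
Proof.
move=> C0 LaE; rewrite -sum_rising_two -sum_rising_one mulr_sumr mulr_suml mulr_sumr.
rewrite -big_split; apply: ler_sum => j _ /=.
have j2 : 0 < j%:R + 2 :> R by rewrite ltr_wpDl.
have /andP[g0 _] := @gam01 R j.
have := noise_weight_le alpha12 sigma_gt0 D_gt0 eps_gt0 C0 eta_gt0 g0.
rewrite LaE => H; rewrite /a mulrCA.
have c0 : 0 <= (j%:R + 1) * (j%:R + 2) :> R by rewrite mulr_ge0// addr_ge0.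
apply: le_trans (ler_wpM2l c0 H) _.
rewrite le_eqVlt; apply/orP; left; apply/eqP.
by rewrite /gam; field; rewrite gt_eqF.
Qed.

Lemma noise_coef_gt0 j : 0 < a j.
Proof.
have j1 : 0 < j%:R + 1 :> R by rewrite ltr_wpDl.
have j2 : 0 < j%:R + 2 :> R by rewrite ltr_wpDl.
rewrite /a; apply: mulr_gt0; first exact: mulr_gt0.
have /andP[g0 _] := @gam01 R j; have s0 := noise_scale_gt0 alpha12 sigma_gt0 D_gt0 eps_gt0.
by rewrite /noise_weight mulr_gt0// powR_gt0 ?divr_gt0// mulr_gt0.
Qed.

Let mQ k : measurable_fun [set: Omega] (Q k).
Proof.
apply: measurable_funM => //; apply: (measurableT_comp (measurable_powR _)).
apply: measurable_enorm.
exact: (measurable_noise h_proper h_lsc h_convex h_bounded G_meas xi_iid).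
Qed.

Lemma measurable_gap : measurable_fun [set: Omega]
  (fun w => (objective f h (st K w).2 - optimal_value f h)%E).
Proof.
have [[f_gt _] [h_gt _]] := (f_proper, h_proper).
apply: emeasurable_funB => //.
exact: (measurableT_comp (measurable_lsc_rV (lscD f_gt h_gt f_lsc h_lsc))
  (measurable_iterate h_proper h_lsc h_convex h_bounded G_meas xi_iid x0 0 eta_gt0 K).2).
Qed.

Let kk_gt0 : 0 < k_ * (k_ + 1).
Proof. by rewrite mulr_gt0 ?ltr_wpDl// ltr0n. Qed.

Let Q_ge0 j w : 0 <= Q j w.
Proof. by rewrite divr_ge0 ?powR_ge0. Qed.

Let integral_Q_le k : (\int[P]_w (Q k w)%:E <= 1%:E)%E.
Proof.
have sa : 0 < sigma `^ alpha by rewrite powR_gt0.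
(* The noise does not depend on the comparison point of the accumulated sum; 0 is passed for it. *)
have := @integral_error_le _ _ _ _ h_proper h_lsc h_convex dom_sub h_bounded _ _ _ _
  G_meas _ _ _ _ xi_iid _ 0 x0_dom _ eta_gt0 k (fun r => r `^ alpha / sigma `^ alpha) 1.
apply.
- by apply: measurable_funM => //; exact: measurable_powR.
- by move=> r; rewrite divr_ge0// powR_ge0.
- move=> x fx; under eq_integral do rewrite mulrC EFinM.
  have merr := measurable_oracle_error mu G_meas
    (measurable_cst (x : borel_rV R n)) (@measurable_id _ Xi setT).
  rewrite ge0_integralZl_EFin ?invr_ge0 ?powR_ge0//; last 2 first.
  - by move=> s _; rewrite lee_fin powR_ge0.
  - by apply/measurable_EFinP; exact: (measurableT_comp (measurable_powR _) merr).
  apply: le_trans (lee_wpmul2l _ (G_moment fx)) _.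
    by rewrite lee_fin invr_ge0 powR_ge0.
  by rewrite -EFinM mulVf// gt_eqF.
Qed.

Let integrable_Q k : P.-integrable [set: Omega] (EFin \o Q k).
Proof.
apply/integrableP; split; first exact/measurable_EFinP.
under eq_integral do rewrite /= ger0_norm ?Q_ge0//.
exact: le_lt_trans (integral_Q_le k) (ltry _).
Qed.

Lemma expectation_bound :
  base + k_ * (k_ + 1) * (k_ + 2) / 3 * (eta * Lambda alpha sigma D eps ^+ 2)
    + eps / 8 * (k_ * (k_ + 1)) <= 7 / 8 * eps * (k_ * (k_ + 1)) ->
  (\int[P]_w (objective f h (st K w).2 - optimal_value f h) <= eps%:E)%E.
Proof.
move=> budget; have [u [hu umin]] := objective_argmin.
have hz w : effective_domain h (st K w).2.
  by have [] := iterate_dom h_proper h_lsc h_convex dom_sub h_bounded G xi x0_dom eta K w.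
have gE w : (objective f h (st K w).2 - optimal_value f h)%E = (gap u (st K w).2)%:E.
  exact: gapE.
pose al j := a j / (k_ * (k_ + 1)); pose be (j : nat) := 2 * (j%:R + 1) / (k_ * (k_ + 1)).
have iQ (j : 'I_K) : P.-integrable [set: Omega] (fun w => (al j)%:E * (Q j w)%:E)%E.
  exact: (integrableZl measurableT _ (integrable_Q j)).
have Zm j : P.-integrable [set: Omega] (EFin \o Z u j) /\ (\int[P]_w (Z u j w)%:E = 0)%E.
  exact: (martingale_difference h_proper h_lsc h_convex dom_sub h_bounded D_gt0 diam
    G_meas alpha12 G_integrable xi_iid x0_dom hu eta_gt0 j G_moment).
have iZ (j : 'I_K) : P.-integrable [set: Omega] (fun w => (be j)%:E * (Z u j w)%:E)%E.
  by apply: integrableZl => //; exact: (Zm j).1.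
have iC : P.-integrable [set: Omega] (fun=> (base / (k_ * (k_ + 1)))%:E).
  exact: finite_measure_integrable_cst.
have iSQ := integrable_sum measurableT (index_enum 'I_K) (fun j _ => iQ j).
have iSZ := integrable_sum measurableT (index_enum 'I_K) (fun j _ => iZ j).
apply: (@le_trans _ _ (\int[P]_w ((base / (k_ * (k_ + 1)))%:E
    + \sum_(j < K) ((al j)%:E * (Q j w)%:E)
    + \sum_(j < K) ((be j)%:E * (Z u j w)%:E))%E)%E).
  apply: ge0_le_integral => //.
  - move=> w _; rewrite gE lee_fin subr_ge0 -lee_fin !EFinD.
    have := umin (st K w).2; rewrite /objective.
    by rewrite !fineK//; apply: dom_fin_num => //; exact: dom_sub.
  - exact: measurable_gap.
  - have mi g := @measurable_int _ _ _ P setT g.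
    by apply: emeasurable_funD; [apply: emeasurable_funD => //|]; exact: mi.
  - move=> w _; rewrite gE.
    have -> : \sum_(j < K) ((al j)%:E * (Q j w)%:E)%E = (\sum_(j < K) al j * Q j w)%:E.
      by rewrite -sumEFin.
    have -> : \sum_(j < K) ((be j)%:E * (Z u j w)%:E)%E = (\sum_(j < K) be j * Z u j w)%:E.
      by rewrite -sumEFin.
    rewrite -!EFinD lee_fin -(ler_pM2l kk_gt0).
    apply: le_trans (gap_path_bound w hu) _.
    have distr x y z : k_ * (k_ + 1) * (x / (k_ * (k_ + 1)) + y + z) =
        x + k_ * (k_ + 1) * y + k_ * (k_ + 1) * z.
      by field; rewrite !gt_eqF ?ltr_wpDl ?ltr0n.
    rewrite distr !mulr_sumr le_eqVlt; apply/orP; left; apply/eqP.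
    congr (_ + _ + _); apply: eq_bigr => j _.
      by rewrite /al; field; rewrite !gt_eqF ?ltr_wpDl ?ltr0n.
    by rewrite /be; field; rewrite !gt_eqF ?ltr_wpDl ?ltr0n.
rewrite integralD//; last exact: integrableD.
rewrite integralD// integral_cst_probability !integral_sum//.
rewrite [X in (_ + X)%E]big1 ?adde0; last first.
  by move=> j _; rewrite integralZl ?(Zm j).2 ?mule0//; exact: (Zm j).1.
apply: (@le_trans _ _ ((base / (k_ * (k_ + 1)))%:E + \sum_(j < K) (al j)%:E)%E).
  rewrite leeD2l//; apply: lee_sum => j _.
  rewrite (integralZl measurableT (integrable_Q j)) -[leRHS]mule1 lee_wpmul2l ?integral_Q_le//.
  by rewrite lee_fin divr_ge0 ?(ltW kk_gt0)// ltW// noise_coef_gt0.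
rewrite sumEFin -EFinD lee_fin -mulr_suml -mulrDl ler_pdivrMr//.
have LaE : 1 `^ (alpha - 1)^-1 * Lambda alpha sigma D eps ^+ 2 =
  Lambda alpha sigma D eps ^+ 2 by rewrite powR1 mul1r.
have ek : 0 <= eps * (k_ * (k_ + 1)) by rewrite mulr_ge0// ltW.
have := sum_noise_weight_le ltr01 LaE; rewrite mul1r; lra.
Qed.

Lemma probability_bound (delta lam La : R) : 0 < delta < 1 ->
  (forall x, effective_domain f x ->
    \int[mu]_s (expR (oracle_error mu G x s `^ alpha / sigma `^ alpha))%:E
      <= (expR 1)%:E)%E ->
  (1 + ln (2 / delta)) `^ (alpha - 1)^-1 * Lambda alpha sigma D eps ^+ 2 = La ^+ 2 ->
  base + k_ * (k_ + 1) * (k_ + 2) / 3 * (eta * La ^+ 2)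
    + eps / 8 * (k_ * (k_ + 1)) <= 7 / 8 * eps * (k_ * (k_ + 1)) ->
  0 < lam -> lam <= 1 \/ alpha = 2 ->
  16 * D * sigma * (ln (2 / delta) + k_ * lam `^ alpha) <= lam * k_ * eps ->
  ((1 - delta)%:E <=
    P [set w | (objective f h (st K w).2 - optimal_value f h <= eps%:E)%E])%E.
Proof.
move=> /andP[d0 d1] exp_moment LaE budget lam0 lam1 lamE.
have [u [hu umin]] := objective_argmin.
have hz w : effective_domain h (st K w).2.
  by have [] := iterate_dom h_proper h_lsc h_convex dom_sub h_bounded G xi x0_dom eta K w.
have gE w : (objective f h (st K w).2 - optimal_value f h)%E = (gap u (st K w).2)%:E.
  exact: gapE.
set l := ln (2 / delta) in LaE lamE.
have d2 : 1 < 2 / delta by rewrite ltr_pdivlMr//; lra.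
have l0 : 0 < l by rewrite ln_gt0.
have k0 : 0 < k_ by rewrite ltr0n.
have k1 : 0 < k_ + 1 by rewrite ltr_wpDl.
have expl : expR (- l) = delta / 2.
  by rewrite expRN lnK ?posrE ?divr_gt0// invf_div.
pose A := \sum_(j < K) a j.
have A0 : 0 < A.
  rewrite /A -(prednK K_gt0) big_ord_recl ltr_pwDl ?noise_coef_gt0//.
  by apply: sumr_ge0 => j _; rewrite ltW// noise_coef_gt0.
(* Normalizing by [A] makes this a convex combination, so the exponential moment of each [Q j]
   passes to [Y1] although the errors are dependent. *)
pose Y1 w := \sum_(j < K) (a j / A) * Q j w.
pose Y2 w := lam / (k_ * D * sigma) * \sum_(j < K) (j%:R + 1) * Z u j w.
have mY1 : measurable_fun [set: Omega] Y1.
  by apply: measurable_sum => j; exact: measurable_funM.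
have mY2 : measurable_fun [set: Omega] Y2.
  apply: measurable_funM => //.
  exact: (measurable_martingale h_proper h_lsc h_convex h_bounded G_meas xi_iid x0 u eta_gt0 K).
pose bad1 := [set w | 1 + l <= Y1 w].
pose bad2 := [set w | k_ * lam `^ alpha + l <= Y2 w].
have mle (Y : Omega -> R) c : measurable_fun [set: Omega] Y ->
    measurable [set w | c <= Y w].
  move=> mY; rewrite -[X in measurable X]setTI.
  exact: (measurable_fun_le measurableT (measurable_cst c) mY).
have Pbad1 : (P bad1 <= (delta / 2)%:E)%E.
  rewrite -expl; apply: expR_tail_bound => //.
  have p0 (j : 'I_K) : 0 <= a j / A by rewrite divr_ge0 ?(ltW A0)// ltW// noise_coef_gt0.
  apply: (integral_expR_Jensen (q := fun j : 'I_K => Q j)) => //.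
    by rewrite -mulr_suml divff// gt_eqF.
  move=> j; have := @integral_error_le _ _ _ _ h_proper h_lsc h_convex dom_sub h_bounded
    _ _ _ _ G_meas _ _ _ _ xi_iid _ 0 x0_dom _ eta_gt0 j
    (fun r => expR (r `^ alpha / sigma `^ alpha)) (expR 1).
  apply => //.
  by apply: (measurableT_comp (@measurable_expR R)); exact: measurable_funM.
have Pbad2 : (P bad2 <= (delta / 2)%:E)%E.
  rewrite -expl; apply: expR_tail_bound => //.
  exact: (martingale_mgf h_proper h_lsc h_convex dom_sub h_bounded D_gt0 diam
    G_meas sigma_gt0 alpha12 G_integrable xi_iid x0_dom hu eta_gt0 K_gt0 (ltW lam0) lam1
    exp_moment (leqnn K)).
set good := [set w | _].
have mgood : measurable good.
  rewrite -[X in measurable X]setTI.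
  exact: emeasurable_fun_infty_c measurableT measurable_gap _.
have badE : ~` good `<=` bad1 `|` bad2.
  move=> w; apply: contra_notP => /not_orP[/negP nb1 /negP nb2].
  rewrite /good /= gE lee_fin -(ler_pM2l kk_gt0).
  apply: le_trans (gap_path_bound w hu) _.
  have H1 : \sum_(j < K) a j * Q j w <= (1 + l) * A.
    move: nb1; rewrite -ltNge /Y1 => /ltW; rewrite -(ler_pM2r A0); apply: le_trans.
    rewrite mulr_suml le_eqVlt; apply/orP; left; apply/eqP; apply: eq_bigr => j _.
    by field; rewrite gt_eqF.
  (* Off [bad2], the choice of lam bounds the left side by k^2 eps / 8, within the eighth of eps
     that the budget left free. *)
  have H2 : 2 * \sum_(j < K) (j%:R + 1) * Z u j w <= eps / 8 * (k_ * (k_ + 1)).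
    have c0 : 0 < k_ * D * sigma by rewrite !mulr_gt0.
    move: nb2; rewrite -ltNge /Y2 => /ltW.
    rewrite mulrAC ler_pdivrMr// mulrC -ler_pdivlMr// => /(ler_wpM2l (ler0n _ 2)).
    move/le_trans; apply.
    apply: (@le_trans _ _ (k_ * (k_ * eps / 8))); last first.
      have : 0 <= k_ * eps by rewrite mulr_ge0// ltW.
      nra.
    rewrite [leLHS](_ : _ = k_ * ((16 * D * sigma * (l + k_ * lam `^ alpha)) / lam / 8));
      last by field; rewrite gt_eqF.
    rewrite ler_pM2l// ler_pM2r// ler_pdivrMr//.
    by rewrite (_ : _ * lam = lam * k_ * eps); last by ring.
  have C0 : 0 < 1 + l by lra.
  have := sum_noise_weight_le C0 LaE; rewrite -/A => H3.
  move: H1 H2 H3 budget; lra.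
have Pbad : (P (~` good) <= delta%:E)%E.
  apply: (@le_trans _ _ (P (bad1 `|` bad2))).
    apply: le_measure; rewrite ?inE//; first exact: measurableC.
    by apply: measurableU; exact: mle.
  apply: le_trans (measureU2 _ _ _) _; [exact: mle|exact: mle|].
  rewrite (splitr delta) EFinD; exact: leeD.
rewrite -(setCK good) probability_setC; last exact: measurableC.
by rewrite EFinB leeB.
Qed.

End Convergence.

(* lam is the maximizer of the Chernoff exponent lam t - k lam^alpha, truncated
   at 1 when alpha < 2. *)
Lemma chernoff_parameter (R : realType) (alpha D sigma eps k l : R) :
  1 < alpha <= 2 -> 0 < D -> 0 < sigma -> 0 < eps -> 0 < k -> 0 < l ->
  ((16 * alpha * D * sigma / eps) `^ (alpha / (alpha - 1)) + \1_(`]1, 2[) alpha)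
    * (l / (alpha - 1)) <= k ->
  exists lam, [/\ 0 < lam, lam <= 1 \/ alpha = 2
    & 16 * D * sigma * (l + k * lam `^ alpha) <= lam * k * eps].
Proof.
move=> alpha12 D0 s0 e0 k0 l0; have [a1 a2] := andP alpha12.
have a0 : 0 < alpha by lra.
have b0 : 0 < alpha - 1 by lra.
set X := 16 * alpha * D * sigma / eps; have X0 : 0 < X by rewrite divr_gt0// !mulr_gt0.
rewrite mulrA ler_pdivrMr// => Hk.
(* The last condition gives l + k lam^alpha <= alpha k lam^alpha, and the bound 1/X on lam^(alpha-1)
   then yields the claim; equality there is the stationarity condition of the Chernoff exponent. *)
suff [lam [lam0 lam1 lamX laml]] : exists lam,
    [/\ 0 < lam, lam <= 1 \/ alpha = 2, lam `^ (alpha - 1) <= X^-1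
      & l <= (alpha - 1) * (k * lam `^ alpha)].
  exists lam; split=> //.
  have lamE : lam `^ alpha = lam * lam `^ (alpha - 1) by rewrite mulr_powRB1// ltW.
  have klam : 0 < k * lam by rewrite mulr_gt0.
  have H : k * lam `^ alpha <= k * lam / X by rewrite lamE mulrA ler_pM2l.
  apply: (@le_trans _ _ (16 * D * sigma * (alpha * (k * lam `^ alpha)))).
    by rewrite ler_pM2l ?mulr_gt0//; lra.
  rewrite [leLHS](_ : _ = X * eps * (k * lam `^ alpha)); last first.
    by rewrite /X; field; rewrite gt_eqF.
  apply: le_trans (ler_wpM2l _ H) _; first by rewrite mulr_ge0// ltW.
  by rewrite le_eqVlt; apply/orP; left; apply/eqP; field; rewrite gt_eqF.
have Xi0 : 0 < X^-1 by rewrite invr_gt0.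
have [alpha2|an2] := eqVneq alpha 2.
  exists X^-1; split=> //; first by right.
    by rewrite alpha2 (_ : 2 - 1 = 1); [rewrite powRr1// ltW|ring].
  move: Hk; rewrite alpha2 (_ : 2 / (2 - 1) = 2%:R); last by field.
  rewrite (_ : 2 - 1 = 1) ?mulr1 ?mul1r; last by ring.
  rewrite indicE memNset ?addr0; last by rewrite /= in_itv/= ltxx andbF.
  rewrite !powR_mulrn ?(ltW X0) ?(ltW Xi0)// exprVn -ler_pdivlMl ?exprn_gt0//.
  by rewrite mulrC.
have a2' : alpha < 2 by rewrite lt_neqAle an2.
move: Hk; rewrite indicE mem_set ?mulrDl ?mul1r; last by rewrite /= in_itv/= a1.
set Xq := X `^ _ => Hk; have Xq0 : 0 < Xq by rewrite powR_gt0.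
have Xl0 : 0 < Xq * l by rewrite mulr_gt0.
have [r1|r1] := leP (X^-1 `^ (alpha - 1)^-1) 1; last first.
  (* The stationary point lies beyond 1. With lam = 1 the requirement is l <= (alpha - 1) k, which
     the indicator term of the hypothesis provides. *)
  exists 1; split=> //; first by left.
    rewrite powR1 leNgt; apply/negP => X1.
    have : X^-1 `^ (alpha - 1)^-1 <= 1 `^ (alpha - 1)^-1.
      by apply: ge0_ler_powR; rewrite ?nnegrE ?invr_ge0 ?(ltW b0) ?(ltW X0)// ltW.
    by rewrite powR1 leNgt r1.
  by rewrite powR1 mulr1; lra.
exists (X^-1 `^ (alpha - 1)^-1); split=> //.
- by rewrite powR_gt0.
- by left.
- by rewrite -powRrM mulVf ?gt_eqF// powRr1// ltW.
have -> : (X^-1 `^ (alpha - 1)^-1) `^ alpha = Xq^-1.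
  rewrite -powRrM (mulrC _ alpha) -(powR_inv1 (ltW X0)) powRAC.
  by rewrite powR_inv1 ?powR_ge0.
by rewrite !mulrA ler_pdivlMr//; lra.
Qed.

Theorem theorem2
  (R : realType) (n : nat)
  (f h : 'rV[R]_n -> \bar R)
  (f_proper : proper_function f) (h_proper : proper_function h)
  (f_lsc : lower_semicontinuous f) (h_lsc : lower_semicontinuous h)
  (f_convex : econvex_function f) (h_convex : econvex_function h)
  (dom_sub : effective_domain h `<=` effective_domain f)
  (Lf Hf Mf nu : R)
  (Lf_ge0 : 0 <= Lf) (Hf_ge0 : 0 <= Hf) (Mf_ge0 : 0 <= Mf)
  (nu01 : 0 < nu < 1)
  (f_subgrad : forall x y gx gy : 'rV[R]_n,
     effective_domain f x -> effective_domain f y ->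
     subdifferential f x gx -> subdifferential f y gy ->
     enorm (gy - gx)
       <= Lf * enorm (y - x) + Hf * enorm (y - x) `^ nu + Mf)
  (h_bounded : bounded_set (effective_domain h))
  (dX : measure_display) (Xi : measurableType dX) (mu : probability Xi R)
  (G : 'rV[R]_n -> Xi -> 'rV[R]_n)
  (G_meas : measurable_fun [set: borel_rV R n * Xi]
     (fun p : borel_rV R n * Xi => G p.1 p.2 : borel_rV R n))
  (sigma alpha : R) (sigma_gt0 : 0 < sigma) (alpha12 : 1 < alpha <= 2)
  (G_integrable : forall (x : 'rV[R]_n) (j : 'I_n), effective_domain f x ->
     mu.-integrable [set: Xi] (fun s => (G x s 0 j)%:E))
  (G_unbiased : forall x, effective_domain f x ->
     subdifferential f x (mean_oracle mu G x))
  (G_moment : forall x, effective_domain f x ->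
     ('E_mu[fun s => (oracle_error mu G x s `^ alpha)%R]
       <= (sigma `^ alpha)%:E)%E)
  (Dh := diameter (effective_domain h)) (Dh_gt0 : 0 < Dh)
  (dO : measure_display) (Omega : measurableType dO) (P : probability Omega R)
  (xi : nat -> Omega -> Xi) (xi_iid : iid_samples P mu xi)
  (x0 : 'rV[R]_n) (x0_dom : effective_domain h x0)
  (eps delta : R) (eps01 : 0 < eps < 1) (delta01 : 0 < delta < 1)
  (K : nat) (K_ge1 : (1 <= K)%N) :
  let L := Lsmooth Hf nu in
  let La := Lambda alpha sigma Dh eps in
  let Lt := Lambda_tilde alpha sigma Dh delta eps in
  let k_ : R := K%:R in
  let eta := min_inv (4 * (Lf + L (eps / k_)))
    (Num.sqrt (6 / ((Mf ^+ 2 + La ^+ 2) * (2 * k_ + 3) * (k_ + 2) * k_)) * Dh) in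
  let eta' := min_inv (4 * (Lf + L (eps / k_)))
    (Num.sqrt (2 / ((Mf ^+ 2 + Lt ^+ 2) * (k_ + 2) ^+ 2 * k_)) * Dh) in
  let zK (e : R) (w : Omega) :=
    zseq h G (fun k => 2 / (k%:R + 2)) (fun k => (k%:R + 2) * e / 2)
      x0 (fun k => xi k w) K in
  let gap (z : 'rV[R]_n) := (objective f h z - optimal_value f h)%E in
  (Num.max (Num.sqrt (48 * Dh ^+ 2 * Lf / eps))
    (Num.max ((48 * Dh ^+ 2 * L eps / eps) `^ ((1 + nu) / (1 + 3 * nu)))
    (Num.max ((24 * Dh) ^+ 2 * (Mf + La) ^+ 2 / (3 * eps ^+ 2))
      2)) <= k_ ->
   (\int[P]_w gap (zK eta w) <= eps%:E)%E)
  /\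
  ((forall x, effective_domain f x ->
      ('E_mu[fun s => expR (oracle_error mu G x s `^ alpha / sigma `^ alpha)%R]
        <= (expR 1)%:E)%E) ->
   Num.max (Num.sqrt (64 * Dh ^+ 2 * Lf / eps))
    (Num.max ((64 * Dh ^+ 2 * L eps / eps) `^ ((1 + nu) / (1 + 3 * nu)))
    (Num.max (2 * (16 * Dh) ^+ 2 * (Mf + Lt) ^+ 2 / eps ^+ 2)
    (Num.max (((16 * alpha * Dh * sigma / eps) `^ (alpha / (alpha - 1))
                + \1_(`]1, 2[) alpha) * (ln (2 / delta) / (alpha - 1)))
      2))) <= k_ ->
   ((1 - delta)%:E <= P [set w | (gap (zK eta' w) <= eps%:E)%E])%E).
Proof.
move=> L La Lt k_ eta eta' zK gap.
have [e0 e1] := andP eps01; have [nu0 nu1] := andP nu01.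
have k0 : 0 < k_ by rewrite ltr0n.
have ek0 : 0 < eps / k_ by rewrite divr_gt0.
have LaP : 0 < La by exact: Lambda_gt0.
have L0 e : 0 <= L e by exact: Lsmooth_ge0.
have diam x y : effective_domain h x -> effective_domain h y -> enorm (x - y) <= Dh.
  by move=> hx hy; exact: le_diameter.
have moment x : effective_domain f x ->
    (\int[mu]_s (oracle_error mu G x s `^ alpha)%:E <= (sigma `^ alpha)%:E)%E.
  by move=> /G_moment; rewrite unlock.
have a0 : 0 <= 4 * (Lf + L (eps / k_)) by rewrite mulr_ge0// addr_ge0.
have etaL e : e * (4 * (Lf + L (eps / k_))) <= 1 ->
    4 * e * (Lf + Lsmooth Hf nu (eps / k_)) <= 1.
  by rewrite mulrA (mulrC e).
split.
  rewrite !ge_max => /and4P[HLf HL HM k2].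
  have S0 : 0 < Mf ^+ 2 + La ^+ 2 by rewrite ltr_wpDl ?sqr_ge0// exprn_gt0.
  have HS := variance_budget_expectation Mf_ge0 (ltW LaP) e0 HM.
  have [b0 Hb1 Hb2] := stepsize_expectation Dh_gt0 S0 e0 k2 HS.
  have [eta0 etaa etab etai] := min_invP a0 b0.
  rewrite -/eta in eta0 etaa etab etai.
  have budget := stepsize_budget Lf_ge0 (L0 _) Mf_ge0 Dh_gt0 e0 k2 b0 eta0 etab etai
    (sqrt_budget Lf_ge0 k0 e0 (ltr0Sn _ 47) HLf)
    (Lsmooth_budget nu01 k0 e0 (ltr0Sn _ 47) HL) Hb1 Hb2.
  apply: (expectation_bound f_proper h_proper f_lsc h_lsc h_convex dom_sub Hf_ge0 nu01
    f_subgrad h_bounded G_meas sigma_gt0 alpha12 G_integrable G_unbiased moment Dh_gt0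
    diam xi_iid x0_dom e0 eta0 K_ge1 (etaL _ etaa)).
  exact: budget.
move=> exp_moment'; rewrite !ge_max => /and5P[HLf HL HM Hl k2].
have exp_moment x : effective_domain f x ->
    (\int[mu]_s (expR (oracle_error mu G x s `^ alpha / sigma `^ alpha))%:E
      <= (expR 1)%:E)%E.
  by move=> /exp_moment'; rewrite unlock.
have [d0 d1] := andP delta01.
have l0 : 0 < ln (2 / delta) by rewrite ln_gt0// ltr_pdivlMr//; lra.
have LtE : (1 + ln (2 / delta)) `^ (alpha - 1)^-1 * La ^+ 2 = Lt ^+ 2.
  by rewrite [RHS]sqr_sqrtr// mulr_ge0 ?powR_ge0 ?sqr_ge0.
have LtP : 0 < Lt.
  rewrite sqrtr_gt0 mulr_gt0 ?powR_gt0 ?exprn_gt0//; lra.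
have S0 : 0 < Mf ^+ 2 + Lt ^+ 2 by rewrite ltr_wpDl ?sqr_ge0// exprn_gt0.
have HS := variance_budget_probability Mf_ge0 (ltW LtP) e0 HM.
have [b0 Hb1 Hb2] := stepsize_probability Dh_gt0 S0 e0 k2 HS.
have [eta0 etaa etab etai] := min_invP a0 b0.
rewrite -/eta' in eta0 etaa etab etai.
have D2 : 0 <= Dh ^+ 2 by rewrite sqr_ge0.
(* Both parts share one budget, stated with the constant 48, so the constants 64 are lowered to
   it. *)
have le48 x : 0 <= x -> 48 * Dh ^+ 2 * x <= 64 * Dh ^+ 2 * x.
  by move=> x0'; rewrite ler_wpM2r// ler_wpM2r// ler_nat.
have HLf' : 48 * Dh ^+ 2 * Lf <= eps * k_ ^+ 2.
  exact: le_trans (le48 _ Lf_ge0) (sqrt_budget Lf_ge0 k0 e0 (ltr0Sn _ 63) HLf).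
have HL' : 48 * Dh ^+ 2 * L (eps / k_) <= eps * k_ ^+ 2.
  exact: le_trans (le48 _ (L0 _)) (Lsmooth_budget nu01 k0 e0 (ltr0Sn _ 63) HL).
have budget := stepsize_budget Lf_ge0 (L0 _) Mf_ge0 Dh_gt0 e0 k2 b0 eta0 etab etai
  HLf' HL' Hb1 Hb2.
have [lam [lam0 lam1 lamE]] := chernoff_parameter alpha12 Dh_gt0 sigma_gt0 e0 k0 l0 Hl.
apply: (probability_bound f_proper h_proper f_lsc h_lsc h_convex dom_sub Hf_ge0 nu01
  f_subgrad h_bounded G_meas sigma_gt0 alpha12 G_integrable G_unbiased Dh_gt0
  diam xi_iid x0_dom e0 eta0 K_ge1 (etaL _ etaa) delta01 exp_moment LtE _ lam0 lam1 lamE).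
exact: budget.
Qed.
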